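(* Let $d\ge 1$, $\boldsymbol{\nu}\in\mathbb{N}_0^d$ and $[a,b]\subset\mathbb{R}$. Suppose that $\phi$ and $\rho_0$ are $\boldsymbol{\nu}$-admissible, and that for $q=1$ and every $\boldsymbol{\eta}\in\mathbb{N}_0^d$ with $\boldsymbol{\eta}\le\boldsymbol{\nu}$ the $(q,\boldsymbol{\eta})$-decay condition holds on $[a,b]$ with constant $B_{1,\boldsymbol{\eta}}$. For $t\in[a,b]$ consider the distribution $g_t(y_0,\boldsymbol{y}):=\delta(t-\phi(y_0,\boldsymbol{y}))$, where $\delta$ is the Dirac delta, and its preintegration $P_0g_t(\boldsymbol{y})=\int_{-\infty}^\infty\delta(t-\phi(y_0,\boldsymbol{y}))\,\rho_0(y_0)\,\mathrm{d}y_0$, that is, $$P_0g_t(\boldsymbol{y})=\begin{cases}\dfrac{\rho_0(\xi(t,\boldsymbol{y}))}{D^0\phi(\xi(t,\boldsymbol{y}),\boldsymbol{y})}&\text{if }\boldsymbol{y}\in U_t,\\[2mm]0&\text{if }\boldsymbol{y}\in\mathbb{R}^d\setminus U_t.\end{cases}$$ Then for every $t\in[a,b]$, $P_0g_t\in\mathcal{H}^{\boldsymbol{\nu}}_d\cap C^{\boldsymbol{\nu}}(\mathbb{R}^d)$, and $$\sup_{t\in[a,b]}\|P_0g_t\|_{\mathcal{H}^{\boldsymbol{\nu}}_d}\le\Bigg(\sum_{\boldsymbol{\eta}\le\boldsymbol{\nu}}\frac{\big(8^{|\boldsymbol{\eta}|}|\boldsymbol{\eta}|!\big)^2B_{1,\boldsymbol{\eta}}}{\gamma_{\boldsymbol{\eta}}}\Bigg)^{1/2}<\infty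 .$$
   Context: Notation. $\mathbb{N}_0=\{0,1,2,\dots\}$. For multi-indices, $|\boldsymbol{\nu}|$ is the sum of the components, $\mathrm{supp}(\boldsymbol{\nu})$ the set of indices of nonzero components, $\le$ and $+$ are componentwise, and $\boldsymbol{e}_i$ is the multi-index with $i$th component 1 and all others 0. Points of $\mathbb{R}^{d+1}$ are written $(y_0,\boldsymbol{y})$ with $\boldsymbol{y}=(y_1,\dots,y_d)\in\mathbb{R}^d$ (coordinates indexed $0,\dots,d$; those of $\mathbb{R}^d$ indexed $1,\dots,d$); multi-indices in $\mathbb{N}_0^{d+1}$ are written $(\nu_0,\boldsymbol{\nu})$ correspondingly. $D^i=\partial/\partial y_i$ and $D^{\boldsymbol{\eta}}=\prod_i\partial^{\eta_i}/\partial y_i^{\eta_i}$ (also used for weak derivatives). $C^{\boldsymbol{\nu}}$ is the space of continuous functions $g$ such that $D^{\boldsymbol{\eta}}g$ is continuous for all $\boldsymbol{\eta}\le\boldsymbol{\nu}$. Densities and weights. For $i=0,\dots,d$, $\rho_i$ is a probability density on $\mathbb{R}$ with support $\mathbb{R}$ and cdf $\Phi_i$. The $\psi_i:\mathbb{R}\to\mathbb{R}$, $i=0,\dots,d$, are strictly positive integrable functions, and it is assumed throughout that $\int_{-\infty}^\infty \frac{\Phi_i(z)(1-\Phi_i(z))}{\psi_i(z)}\,\mathrm{d}z<\infty$ for $i=1,\dots,d$. Weight parameters: $\gamma_{\mathfrak{u}}>0$ for $\mathfrak{u}\subseteq\{0,\dots,d\}$, $\gamma_\emptyset=1$, and $\gamma_{\boldsymbol{\eta}}:=\gamma_{\mathrm{supp}(\boldsymbol{\eta})}$.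 Write $\boldsymbol{\psi}_{\boldsymbol{\eta}}(\boldsymbol{y}_{\boldsymbol{\eta}})=\prod_{i:\eta_i\neq0}\psi_i(y_i)$ and $\boldsymbol{\rho}_{-\boldsymbol{\eta}}(\boldsymbol{y}_{-\boldsymbol{\eta}})=\prod_{i:\eta_i=0}\rho_i(y_i)$. Spaces. For $\boldsymbol{\nu}\in\mathbb{N}_0^d$, $\mathcal{H}^{\boldsymbol{\nu}}_d$ is the space of locally integrable functions $g$ on $\mathbb{R}^d$ (with weak derivatives $D^{\boldsymbol{\eta}}g$, $\boldsymbol{\eta}\le\boldsymbol{\nu}$) whose norm $$\|g\|^2_{\mathcal{H}^{\boldsymbol{\nu}}_d}=\sum_{\boldsymbol{\eta}\le\boldsymbol{\nu}}\frac1{\gamma_{\boldsymbol{\eta}}}\int_{\mathbb{R}^d}|D^{\boldsymbol{\eta}}g(\boldsymbol{y})|^2\,\boldsymbol{\psi}_{\boldsymbol{\eta}}(\boldsymbol{y}_{\boldsymbol{\eta}})\,\boldsymbol{\rho}_{-\boldsymbol{\eta}}(\boldsymbol{y}_{-\boldsymbol{\eta}})\,\mathrm{d}\boldsymbol{y}$$ is finite (indices $1,\dots,d$). $\mathcal{H}^{(\nu_0,\boldsymbol{\nu})}_{d+1}$ is defined in the same way on $\mathbb{R}^{d+1}$ with indices $0,\dots,d$. $\boldsymbol{\nu}$-admissibility. $\phi:\mathbb{R}^{d+1}\to\mathbb{R}$ and $\rho_0$ are called $\boldsymbol{\nu}$-admissible if: (1) $D^0\phi(y_0,\boldsymbol{y})>0$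 for all $(y_0,\boldsymbol{y})\in\mathbb{R}^{d+1}$; (2) for each $\boldsymbol{y}\in\mathbb{R}^d$, $\phi(y_0,\boldsymbol{y})\to\infty$ as $y_0\to\infty$; (3) $\phi\in\mathcal{H}^{(\nu_0,\boldsymbol{\nu})}_{d+1}\cap C^{(\nu_0,\boldsymbol{\nu})}(\mathbb{R}^{d+1})$ with $\nu_0:=|\boldsymbol{\nu}|+1$; (4) $\rho_0\in C^{|\boldsymbol{\nu}|}(\mathbb{R})$. Discontinuity point. For $t\in[a,b]$, $U_t:=\{\boldsymbol{y}\in\mathbb{R}^d:\phi(y_0,\boldsymbol{y})=t\text{ for some }y_0\in\mathbb{R}\}$, and for $\boldsymbol{y}\in U_t$, $\xi(t,\boldsymbol{y})$ is the unique real number with $\phi(\xi(t,\boldsymbol{y}),\boldsymbol{y})=t$. $(q,\boldsymbol{\eta})$-decay condition. Let $q\in\mathbb{N}_0$ and $\boldsymbol{\eta}\le\boldsymbol{\nu}$ with $|\boldsymbol{\eta}|+q\le|\boldsymbol{\nu}|+1$. A function of type $(q,\boldsymbol{\eta})$ is a function, defined for $t\in[a,b]$ and $\boldsymbol{y}\in U_t$, of the form $$h_{q,\boldsymbol{\eta}}(t,\boldsymbol{y})=\frac{(-1)^r\rho_0^{(\beta)}(\xi(t,\boldsymbol{y}))\prod_{\ell=1}^rD^{\boldsymbol{\alpha}_\ell}\phi(\xi(t,\boldsymbol{y}),\boldsymbol{y})}{[D^0\phi(\xi(t,\boldsymbol{y}),\boldsymbol{y})]^{r+q}},$$ where $r\in\mathbb{N}_0$,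 $\boldsymbol{\alpha}_\ell\in\mathbb{N}_0^{d+1}\setminus\{\boldsymbol{e}_0,\boldsymbol{0}\}$ for $\ell=1,\dots,r$, $\beta\in\mathbb{N}_0$ satisfy $r\le2|\boldsymbol{\eta}|+q-1$, $\alpha_{\ell,0}\le|\boldsymbol{\eta}|+q$, $\beta\le|\boldsymbol{\eta}|+q-1$ and $\beta\boldsymbol{e}_0+\sum_{\ell=1}^r\boldsymbol{\alpha}_\ell=(r+q-1,\boldsymbol{\eta})$. The $(q,\boldsymbol{\eta})$-decay condition holds on $[a,b]$ with constant $B_{q,\boldsymbol{\eta}}<\infty$ if every function $h_{q,\boldsymbol{\eta}}$ of type $(q,\boldsymbol{\eta})$ satisfies: for all $t\in[a,b]$, $h_{q,\boldsymbol{\eta}}(t,\boldsymbol{y})\to0$ as $\boldsymbol{y}\to\partial U_t$ (i.e. as $\boldsymbol{y}\in U_t$ tends to any point of the boundary $\partial U_t$), and $$\sup_{t\in[a,b]}\int_{U_t}|h_{q,\boldsymbol{\eta}}(t,\boldsymbol{y})|^2\,\boldsymbol{\psi}_{\boldsymbol{\eta}}(\boldsymbol{y}_{\boldsymbol{\eta}})\,\boldsymbol{\rho}_{-\boldsymbol{\eta}}(\boldsymbol{y}_{-\boldsymbol{\eta}})\,\mathrm{d}\boldsymbol{y}\le B_{q,\boldsymbol{\eta}}.$$ *)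

(* Defs.v *)
From HB Require Import structures.
From mathcomp Require Import all_boot all_order all_algebra.
From mathcomp Require Import all_classical all_reals all_analysis.

Set Implicit Arguments.
Unset Strict Implicit.
Unset Printing Implicit Defensive.

Import Order.TTheory GRing.Theory Num.Theory.
Import numFieldNormedType.Exports.

Local Open Scope classical_set_scope.
Local Open Scope ring_scope.

(* The point (y0, y) of R^{n+1}: coordinate [ord0] is y0, coordinate
   [lift ord0 i] is the i-th coordinate of y. *)
Definition consr (R : Type) (n : nat) (y0 : R) (y : 'rV[R]_n) : 'rV[R]_n.+1 :=
  \row_j oapp (fun i => y ord0 i) y0 (unlift ord0 j).

Lemma consr0 (R : Type) n (y0 : R) (y : 'rV[R]_n) : consr y0 y ord0 ord0 = y0.
Proof. by rewrite mxE unlift_none. Qed.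

Lemma consrS (R : Type) n (y0 : R) (y : 'rV[R]_n) i :
  consr y0 y ord0 (lift ord0 i) = y ord0 i.
Proof. by rewrite mxE liftK. Qed.

Definition rV_display : measure_display. Proof. exact. Qed.

Section measurable_rV.
Variables (R : realType) (n : nat).

Let coord (i : 'I_n) (x : 'rV[R]_n) : R := x ord0 i.

Let rV_set0 : g_sigma_preimage coord set0.
Proof. exact: sigma_algebra0. Qed.

Let rV_setC A : g_sigma_preimage coord A -> g_sigma_preimage coord (~` A).
Proof. exact: sigma_algebraC. Qed.

Let rV_bigcup (F : (set 'rV[R]_n)^nat) :
  (forall i, g_sigma_preimage coord (F i)) ->
  g_sigma_preimage coord (\bigcup_i (F i)).
Proof. exact: sigma_algebra_bigcup. Qed.

(* The product of the Borel sigma-algebras of R, that is, the Borel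
   sigma-algebra of R^n. *)
HB.instance Definition _ := @isMeasurable.Build rV_display
  'rV[R]_n (g_sigma_preimage coord) rV_set0 rV_setC rV_bigcup.

End measurable_rV.

Lemma measurable_coord (R : realType) n (i : 'I_n) :
  measurable_fun [set: 'rV[R]_n] (fun x : 'rV[R]_n => x ord0 i : R).
Proof.
move=> _ Y mY; rewrite setTI; apply: sub_sigma_algebra => /=.
rewrite -bigcup_seq/=; exists i => /=; first by rewrite mem_index_enum.
by exists Y => //; rewrite setTI.
Qed.

Lemma measurable_fun_rV d (T : measurableType d) (R : realType) n
    (f : T -> 'rV[R]_n) :
  (forall i, measurable_fun [set: T] (fun x => f x ord0 i : R)) ->
  measurable_fun [set: T] f.
Proof.
move=> mf _ A mA.
have sub : g_sigma_preimage (fun (i : 'I_n) x => f x ord0 i : R) `<=`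
    measurable.
  apply: smallest_sub; first exact: sigma_algebra_measurable.
  case: n f mf A mA => [|n] f mf A mA; first by rewrite big_ord0.
  rewrite -bigcup_mkord_ord; apply: bigcup_sub => i Ii.
  by move=> _ [B mB <-]; exact: mf.
apply: sub.
by rewrite (g_sigma_preimage_comp (fun (i : 'I_n) (x : 'rV[R]_n) =>
  x ord0 i : R) f); exists A.
Qed.

Lemma measurable_consr (R : realType) n :
  measurable_fun [set: measurableTypeR R * 'rV[R]_n]
    (fun p => consr p.1 p.2 : 'rV[R]_n.+1).
Proof.
apply: measurable_fun_rV => i; case: (unliftP ord0 i) => [j|] ->.
  rewrite (_ : (fun p => _) = (fun y : 'rV[R]_n => y ord0 j : R) \o snd).
    by apply: measurableT_comp => //; exact: measurable_coord.
  by apply/funext => p /=; rewrite consrS.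
rewrite (_ : (fun p => _) = fst); first exact: measurable_fst.
by apply/funext => p /=; rewrite consr0.
Qed.

Section lebesgue_rV.
Variable R : realType.
Local Open Scope ereal_scope.

Section lebesgue_consr.
Variables (n : nat) (mu : {sigma_finite_measure set 'rV[R]_n -> \bar R}).

Definition lebesgue_consr : set 'rV[R]_n.+1 -> \bar R :=
  pushforward (@lebesgue_measure R \x mu) (fun p => consr p.1 p.2).

Let preim_consr A : measurable A ->
  measurable ((fun p : measurableTypeR R * 'rV[R]_n => consr p.1 p.2) @^-1` A).
Proof.
by move=> mA; rewrite -[X in measurable X]setTI; exact: measurable_consr.
Qed.

Let lebesgue_consr0 : lebesgue_consr set0 = 0.
Proof. by rewrite /lebesgue_consr /pushforward preimage_set0 measure0. Qed.

Let lebesgue_consr_ge0 A : 0 <= lebesgue_consr A.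
Proof. by rewrite /lebesgue_consr /pushforward; exact: measure_ge0. Qed.

Let lebesgue_consr_sigma_additive : semi_sigma_additive lebesgue_consr.
Proof.
move=> F mF tF mUF; rewrite /lebesgue_consr /pushforward preimage_bigcup.
apply: measure_semi_sigma_additive.
- by move=> k; exact: preim_consr.
- apply/trivIsetP => /= i j _ _ ij; rewrite -preimage_setI.
  by move/trivIsetP : tF => /(_ _ _ _ _ ij) ->//; rewrite preimage_set0.
- by rewrite -preimage_bigcup; exact: preim_consr.
Qed.

HB.instance Definition _ := isMeasure.Build _ _ _ lebesgue_consr
  lebesgue_consr0 lebesgue_consr_ge0 lebesgue_consr_sigma_additive.

Let lebesgue_consr_sigma_finite : sigma_finite setT lebesgue_consr.
Proof.
have /sigma_finiteP[F [TF ndF Foo]] := sigma_finiteT (@lebesgue_measure R).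
have /sigma_finiteP[G [TG ndG Goo]] := sigma_finiteT mu.
pose H k := F k `*` G k.
have TH : setT = \bigcup_k H k.
  apply/esym/eq_set => -[x y]; apply/propext; split=> // _.
  have [i _ Fix] : (\bigcup_k F k) x by rewrite -TF.
  have [j _ Gjy] : (\bigcup_k G k) y by rewrite -TG.
  exists (maxn i j) => //; split.
    by move: x Fix; exact/subsetPset/ndF/leq_maxl.
  by move: y Gjy; exact/subsetPset/ndG/leq_maxr.
have Hoo k : measurable (H k) /\ (@lebesgue_measure R \x mu) (H k) < +oo.
  have [? ?] := Foo k; have [? ?] := Goo k.
  split; first exact: measurableX.
  by rewrite product_measure1E// lte_mul_pinfty// ge0_fin_numE.
pose tl (x : 'rV[R]_n.+1) : measurableTypeR R * 'rV[R]_n :=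
  (x ord0 ord0, \row_i x ord0 (lift ord0 i)).
have mtl : measurable_fun [set: 'rV[R]_n.+1] tl.
  apply: measurable_fun_pair; first exact: measurable_coord.
  apply: measurable_fun_rV => i.
  under eq_fun do rewrite mxE.
  exact: measurable_coord.
have consrK : cancel (fun p : measurableTypeR R * 'rV[R]_n => consr p.1 p.2) tl.
  case=> y0 y; rewrite /tl /= consr0; congr pair.
  by apply/rowP => i; rewrite mxE consrS.
exists (fun k => tl @^-1` H k); first by rewrite -preimage_bigcup -TH preimage_setT.
move=> k; have [mH Hk] := Hoo k; split.
  by rewrite -[X in measurable X]setTI; exact: mtl.
rewrite /lebesgue_consr /pushforward -comp_preimage.
by rewrite (_ : tl \o _ = id) //; apply/funext => p; exact: consrK.
Qed.

HB.instance Definition _ := Measure_isSigmaFinite.Build _ _ _ lebesgue_consr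
  lebesgue_consr_sigma_finite.

End lebesgue_consr.

Fixpoint lebesgue_rV n : {sigma_finite_measure set 'rV[R]_n -> \bar R} :=
  if n is m.+1 then lebesgue_consr (lebesgue_rV m)
  else \d_(0%R : 'rV[R]_0).

End lebesgue_rV.

Definition mindex (n : nat) := {ffun 'I_n -> nat}.

Definition mnorm n (eta : mindex n) : nat := (\sum_i eta i)%N.

Definition msupp n (eta : mindex n) : {set 'I_n} :=
  finset (fun i => eta i != 0%N).

Definition mle n (eta nu : mindex n) : bool := [forall i, eta i <= nu i]%N.

Definition munit n (i : 'I_n) : mindex n := [ffun j => (j == i) : nat].

Definition mindex0 n : mindex n := [ffun=> 0%N].

Definition mcons n (nu0 : nat) (nu : mindex n) : mindex n.+1 :=
  [ffun j => oapp nu nu0 (unlift ord0 j)].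

(* The finite type of the multi-indices that are <= nu; [mval] is its
   injection into the multi-indices. *)
Definition below n (nu : mindex n) := {dffun forall i : 'I_n, 'I_(nu i).+1}.

Definition mval n (nu : mindex n) (eta : below nu) : mindex n :=
  [ffun i => eta i : nat].

Section derivatives.
Variables (R : realType) (n : nat).
Implicit Types (f : 'rV[R]_n -> R) (s : seq 'I_n) (eta nu : mindex n).

Definition partial (i : 'I_n) f : 'rV[R]_n -> R :=
  'D_(delta_mx ord0 i) f.

(* The first index of [s] is differentiated last. *)
Definition partials s f : 'rV[R]_n -> R := foldr partial f s.

Definition mderive eta f : 'rV[R]_n -> R :=
  partials (flatten [seq nseq (eta i) i | i <- enum 'I_n]) f.

(* ['D_v f] is a total operator in the library, so existence is required
   separately. The partial derivatives of multi-index <= nu are required to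
   exist and be continuous whatever the order of differentiation; by
   Schwarz's theorem their values then do not depend on that order. *)
Definition Cmi nu f : Prop :=
  forall s, (forall i, count_mem i s <= nu i)%N ->
    continuous (partials s f) /\
    (forall i, (count_mem i s < nu i)%N ->
      forall x, derivable (partials s f) x (delta_mx ord0 i)).

Definition test_function f : Prop :=
  (forall nu, Cmi nu f) /\ compact (closure [set x | f x != 0]).

End derivatives.

Definition Ck (R : realType) (k : nat) (f : R -> R) : Prop :=
  forall j, (j <= k)%N ->
    continuous (derive1n j f) /\
    ((j < k)%N -> forall x, derivable (derive1n j f) x 1).

Section densities.
Variable R : realType.
Local Open Scope ereal_scope.

(* As a density is only determined up to a null set, its support is read as
   the closure of the set where it does not vanish, and it is not required to
   be positive everywhere. *)
Definition density_full_support (rho : R -> R) : Prop :=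
  [/\ measurable_fun setT rho,
      (forall x, 0 <= rho x)%R,
      \int[lebesgue_measure]_x (rho x)%:E = 1 &
      closure [set x | rho x != 0%R] = setT].

Definition density_cdf (rho : R -> R) (z : R) : R :=
  fine (\int[lebesgue_measure]_(x in `]-oo, z]) (rho x)%:E).

Definition weight_function (psi : R -> R) : Prop :=
  (forall x, 0 < psi x)%R /\
  lebesgue_measure.-integrable setT (EFin \o psi).

Definition cdf_weight_condition (rho psi : R -> R) : Prop :=
  let Phi := density_cdf rho in
  \int[lebesgue_measure]_z (Phi z * (1 - Phi z) / psi z)%:E < +oo.

End densities.

Section sobolev.
Variables (R : realType) (n : nat).
Implicit Types (g w v : 'rV[R]_n -> R) (eta nu : mindex n).
Variables (rho psi : 'I_n -> R -> R) (gam : {set 'I_n} -> R).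
Local Open Scope ereal_scope.

Definition rV_locally_integrable g : Prop :=
  measurable_fun setT g /\
  forall K, compact K -> \int[lebesgue_rV R n]_(x in K) `|g x|%:E < +oo.

Definition is_weak_derivative eta g w : Prop :=
  rV_locally_integrable w /\
  forall v, test_function v ->
    \int[lebesgue_rV R n]_x (g x * mderive eta v x)%:E =
    ((-1) ^+ mnorm eta)%:E * \int[lebesgue_rV R n]_x (w x * v x)%:E.

(* Weak derivatives are unique up to a null set, so the integrals in [Hnorm]
   do not depend on the one chosen by [get]; the value is junk when there is
   none, which [in_H] excludes. *)
Definition weak_derive eta g : 'rV[R]_n -> R :=
  get [set w | is_weak_derivative eta g w].

Definition mweight eta (y : 'rV[R]_n) : R :=
  (\prod_(i | eta i != 0%N) psi i (y ord0 i)) *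
  (\prod_(i | eta i == 0%N) rho i (y ord0 i)).

Definition Hnorm nu g : \bar R :=
  (\sum_(e : below nu) let eta := mval e in
     ((gam (msupp eta))^-1)%:E *
     \int[lebesgue_rV R n]_y
       (`|weak_derive eta g y| ^+ 2 * mweight eta y)%:E) `^ 2^-1.

Definition in_H nu g : Prop :=
  [/\ rV_locally_integrable g,
      (forall eta, mle eta nu -> exists w, is_weak_derivative eta g w) &
      Hnorm nu g < +oo].

End sobolev.

Section decay.
Variables (R : realType) (d : nat).
Implicit Types (phi : 'rV[R]_d.+1 -> R) (eta nu : mindex d).

Definition admissible (rho psi : 'I_d.+1 -> R -> R) (gam : {set 'I_d.+1} -> R)
    nu phi : Prop :=
  [/\ (forall x, 0 < partial ord0 phi x),
      (forall y : 'rV[R]_d, phi (consr y0 y) @[y0 --> +oo] --> +oo),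
      (let nu' := mcons (mnorm nu).+1 nu in
       in_H rho psi gam nu' phi /\ Cmi nu' phi) &
      Ck (mnorm nu) (rho ord0)].

Definition U phi (t : R) : set 'rV[R]_d :=
  [set y | exists y0, phi (consr y0 y) = t].

(* The real number xi with phi(xi, y) = t when y is in [U phi t], and junk
   otherwise. *)
Definition xi phi (t : R) (y : 'rV[R]_d) : R := get [set y0 | phi (consr y0 y) = t].

(* The parameters r, alpha, beta of the functions of type (q, eta). The upper
   bounds 2|eta| + q - 1 and |eta| + q - 1, and the equation
   beta e_0 + sum_l alpha_l = (r + q - 1, eta), are stated without
   subtraction, which is truncated on nat. *)
Definition type_params (q : nat) eta (r : nat)
    (alpha : 'I_r -> mindex d.+1) (beta : nat) : Prop :=
  [/\ (r < 2 * mnorm eta + q)%N,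
      (forall l, alpha l != munit ord0 /\ alpha l != mindex0 d.+1),
      (forall l, alpha l ord0 <= mnorm eta + q)%N,
      (beta < mnorm eta + q)%N &
      (beta.+1 + \sum_l alpha l ord0 = r + q)%N /\
      (forall i, \sum_l alpha l (lift ord0 i) = eta i)%N].

Definition type_fun phi (rho0 : R -> R) (q r : nat)
    (alpha : 'I_r -> mindex d.+1) (beta : nat) (t : R) (y : 'rV[R]_d) : R :=
  let x := consr (xi phi t y) y in
  (-1) ^+ r * derive1n beta rho0 (xi phi t y) *
  (\prod_l mderive (alpha l) phi x) / partial ord0 phi x ^+ (r + q).

(* [rho0] is the density of y_0; [rho] and [psi] are those of y_1, ..., y_d. *)
Definition decay_condition phi (rho0 : R -> R) (rho psi : 'I_d -> R -> R)
    (q : nat) eta (a b B : R) : Prop :=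
  forall (r : nat) (alpha : 'I_r -> mindex d.+1) (beta : nat),
    type_params q eta alpha beta ->
    let h := type_fun phi rho0 q alpha beta in
    (forall t, t \in `[a, b] ->
      forall z, (closure (U phi t) `\` interior (U phi t)) z ->
        h t y @[y --> within (U phi t) (nbhs z)] --> (0 : R)) /\
    (ereal_sup [set \int[lebesgue_rV R d]_(y in U phi t)
                      (`|h t y| ^+ 2 * mweight rho psi eta y)%:E
               | t in `[a, b]] <= B%:E)%E.

(* The preintegration of the distribution delta (t - phi (y_0, y)), that is,
   its integral against rho0(y_0) dy_0: phi(., y) is strictly increasing, so
   the substitution z = phi(y_0, y) turns it into the integral of
   delta (t - z) against rho0(xi(z, y)) / D^0 phi(xi(z, y), y) dz over the
   range of phi(., y). *)
Definition preint_delta phi (rho0 : R -> R) (t : R) (y : 'rV[R]_d) : R :=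
  if y \in U phi t then
    rho0 (xi phi t y) / partial ord0 phi (consr (xi phi t y) y)
  else 0.

End decay.

(* Main.v *)
Require Import Defs.
From HB Require Import structures.
From mathcomp Require Import all_boot all_order all_algebra.
From mathcomp Require Import all_classical all_reals all_analysis.
From mathcomp Require Import measurable_realfun.
From mathcomp Require Import ring lra zify.

Set Implicit Arguments.
Unset Strict Implicit.
Unset Printing Implicit Defensive.

Import Order.TTheory GRing.Theory Num.Theory.
Import numFieldNormedType.Exports.

Local Open Scope classical_set_scope.
Local Open Scope ring_scope.

(** Where [phi (xi, y) = t], that is, for [y] in the open set [U phi t], the
    implicit function theorem gives [D^i xi = - D^i phi / D^0 phi] at [(xi, y)].
    Hence differentiating a function of type (1, eta) once in [y_i], by the
    product, quotient and chain rules, yields a sum of functions of type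
    (1, eta + e_i). The preintegral is itself the function of type (1, 0), so by
    induction each of its mixed derivatives of order [eta] on [U phi t] is a sum
    of functions of type (1, eta), of which there are at most
    [8 ^ |eta| * |eta|`!]: a product of [r <= 2 |eta|] factors gives
    [4 r + 3 <= 8 (|eta| + 1)] new terms ([is_derive_term], [dterm_valid],
    [size_dterm]). Schwarz's theorem for [phi] ([derive_swap]) identifies the
    derivatives of [phi] met on the way with the canonically ordered ones.

    By the decay condition these functions tend to 0 at the boundary of
    [U phi t], so their extensions by zero are continuous. The extensions are
    moreover differentiable at the boundary with derivative 0, because on a
    segment the mean value theorem applies after the last point outside
    [U phi t] ([is_derive_extension]). This gives the classical regularity of
    the preintegral ([partials_preint], [Cmi_preint]).

    Integration by parts shows that the classical derivatives are weak
    derivatives ([weak_derivative_partials]). The norm, however, is written with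
    an arbitrary weak derivative, so weak derivatives must be shown to be unique
    almost everywhere ([weak_derivative_unique]): products of one-dimensional
    bumps built from [exp (- 1 / x)] approximate the indicators of boxes, and a
    Dynkin argument passes from boxes to Borel sets ([ae_eq0_test]).

    Finally, the square of a sum of [N] terms is at most [N] times the sum of
    their squares; with [N <= 8 ^ |eta| * |eta|`!] and the integral of each
    square bounded by [B eta], this is the stated bound
    ([derivative_integral_le]). *)

(** * Derivatives along lines *)

Lemma is_deriveP (R : numFieldType) (V : normedModType R) (f : V -> R)
    (a v : V) (D : R) :
  h^-1 * (f (h *: v + a) - f a) @[h --> 0^'] --> D <-> is_derive a v f D.
Proof.
split=> [H|[H1 <-]]; last exact: H1.
by split; [apply/cvg_ex; exists D|exact: cvg_lim H].
Qed.

Lemma is_derive_line (R : numFieldType) (V : normedModType R) (f : V -> R)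
    (x v : V) (k D : R) :
  is_derive (k *: v + x) v f D <->
  is_derive k 1 (fun h : R => f (h *: v + x)) D.
Proof.
rewrite -!is_deriveP.
suff -> : (fun h : R => h^-1 * (f (h *: v + (k *: v + x)) - f (k *: v + x))) =
  (fun h : R => h^-1 *
     (f ((h *: (1 : R) + k) *: v + x) - f (k *: v + x))) by [].
apply/funext => h; congr (_ * (f _ - _)).
by rewrite scalerDl [_ *: 1]mulr1 addrA.
Qed.

Lemma MVT_line (R : realType) (V : normedModType R) (f : V -> R) (x v : V)
    (k : R) : (forall y, derivable f y v) ->
  exists2 c, `|c| <= `|k| & f (k *: v + x) - f x = k * 'D_v f (c *: v + x).
Proof.
move=> df.
have dg (h : R) :
    is_derive h 1 (fun h : R => f (h *: v + x)) ('D_v f (h *: v + x)).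
  by apply/is_derive_line; exact: derivableP.
have cg (A : set R) : {within A, continuous (fun h : R => f (h *: v + x))}.
  apply: continuous_subspaceT => h.
  apply/differentiable_continuous/derivable1_diffP.
  exact: (@ex_derive _ _ _ _ _ _ _ (dg h)).
have [k0|k0] := leP 0 k.
  have [c /[!in_itv]/= /andP[c0 ck]] := MVT_segment k0 (fun h _ => dg h) (cg _).
  rewrite scale0r add0r subr0 mulrC => ->; exists c => //.
  by rewrite !ger0_norm.
have [c /[!in_itv]/= /andP[ck c0]] :=
  MVT_segment (ltW k0) (fun h _ => dg h) (cg _).
rewrite scale0r add0r sub0r => h; exists c => //.
  by rewrite (ler0_norm c0) (ler0_norm (ltW k0)) lerN2.
by rewrite -opprB h mulrN opprK mulrC.
Qed.

Lemma near_plane (R : realType) (V : normedModType R) (G : V -> R) (x u v : V)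
    (e : R) : {for x, continuous G} -> 0 < e ->
  exists2 d, 0 < d & forall c c', `|c| <= d -> `|c'| <= d ->
    `|G (c *: u + (c' *: v + x)) - G x| < e.
Proof.
move=> /cvgrPdist_lt /(_ e) /[apply] /nbhs_ballP[r /= r0 br].
pose M := `|u| + `|v| + 1.
have M0 : 0 < M by rewrite /M ltr_wpDl// addr_ge0.
exists (r / 2 / M); first by rewrite !divr_gt0.
move=> c c' cd cd'; rewrite distrC; apply: br.
rewrite -ball_normE/= addrA opprD addrCA subrr addr0 normrN.
rewrite (le_lt_trans (ler_normD _ _))// !normrZ.
have H : `|c| * `|u| + `|c'| * `|v| <= r / 2 / M * (M).
  rewrite /M !mulrDr mulr1 ler_wpDr// ?divr_ge0 ?divr_ge0 ?(ltW r0) ?(ltW M0)//.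
  by rewrite lerD// ler_wpM2r.
rewrite (le_lt_trans H)// divfK ?gt_eqF//.
by rewrite ltr_pdivrMr// ltr_pMr// ltr1n.
Qed.

(** Schwarz's theorem. By the mean value theorem, applied once in each
    direction, one double difference quotient is a value of either mixed
    derivative near [x]; continuity concludes. *)
Lemma derive_swap (R : realType) (V : normedModType R) (f : V -> R) (u v : V) :
  (forall y, derivable f y u) -> (forall y, derivable f y v) ->
  (forall y, derivable ('D_u f) y v) -> (forall y, derivable ('D_v f) y u) ->
  continuous ('D_v ('D_u f)) -> continuous ('D_u ('D_v f)) ->
  'D_v ('D_u f) = 'D_u ('D_v f).
Proof.
have key (u' v' : V) x k : (forall y, derivable f y u') ->
    (forall y, derivable ('D_u' f) y v') ->
    exists c c', [/\ `|c| <= `|k|, `|c'| <= `|k| &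
      (f (k *: v' + (k *: u' + x)) - f (k *: u' + x)) -
      (f (k *: v' + x) - f x) =
      k * (k * 'D_v' ('D_u' f) (c' *: v' + (c *: u' + x)))].
  move=> du duv.
  pose G y := f (k *: v' + y) - f y.
  have dG y : is_derive y u' G ('D_u' f (k *: v' + y) - 'D_u' f y).
    apply: is_deriveB; last exact: derivableP.
    have /derivableP/is_deriveP := du (k *: v' + y).
    under eq_fun do rewrite addrCA.
    by move=> H; apply/(is_deriveP (fun y => f (k *: v' + y))).
  have [c ck ->] := MVT_line x k (fun y => @ex_derive _ _ _ _ _ _ _ (dG y)).
  rewrite (@derive_val _ _ _ _ _ _ _ (dG _)).
  have [c' ck' ->] := MVT_line (c *: u' + x) k duv.
  by exists c, c'.
have aux (p q r s e : R) : p = s -> `|p - q| < e / 2 -> `|s - r| < e / 2 ->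
    `|q - r| <= e.
  move=> -> sq sr; rewrite -(subrKA s) (splitr e) (le_trans (ler_normD _ _))//.
  by rewrite lerD// ltW// distrC.
move=> du dv duv dvu cuv cvu; apply/funext => x.
apply/eqP; rewrite -subr_eq0 -normr_le0.
apply/ler_addgt0Pr => e e0; rewrite add0r.
have e20 : 0 < e / 2 by rewrite divr_gt0.
have [d1 d10 H1] := near_plane v u (cuv x) e20.
have [d2 d20 H2] := near_plane u v (cvu x) e20.
have [k k0 [kd1 kd2]] : exists2 k : R, 0 < k & `|k| <= d1 /\ `|k| <= d2.
  exists (Num.min d1 d2); first by rewrite lt_min d10.
  by rewrite gtr0_norm ?lt_min ?d10// !ge_min !lexx orbT.
have [c [c' [ck ck' E1]]] := key u v x k du duv.
have [b [b' [bk bk' E2]]] := key v u x k dv dvu.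
have E : 'D_v ('D_u f) (c' *: v + (c *: u + x)) =
    'D_u ('D_v f) (b' *: u + (b *: v + x)).
  apply: (mulfI (lt0r_neq0 k0)); apply: (mulfI (lt0r_neq0 k0)).
  apply: etrans (esym E1) _; apply: etrans E2.
  rewrite (addrCA (k *: u)).
  move: (f (k *: v + _)) (f (k *: u + x)) (f (k *: v + x)) (f x) => p q r s.
  ring.
exact: aux E (H1 _ _ (le_trans ck' kd1) (le_trans ck kd1))
  (H2 _ _ (le_trans bk' kd2) (le_trans bk kd2)).
Qed.

(** Splits an increment of [G] along a moving line into its [u]-part and its
    [v]-part. By the mean value theorem the [u]-part is the increment of [s]
    times a factor that converges as soon as ['D_u G] is continuous. *)
Lemma increment_along (R : realType) (V : normedModType R) (G : V -> R)
    (s : R -> R) (u v x : V) : (forall y, derivable G y u) ->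
  continuous ('D_u G) -> {for 0, continuous s} ->
  exists2 W : R -> R, W h @[h --> 0] --> 'D_u G (s 0 *: u + x) &
    forall h, G (s h *: u + (h *: v + x)) - G (s 0 *: u + (h *: v + x)) =
      (s h - s 0) * W h.
Proof.
move=> du cu cs.
have /choice[C HC] : forall h, exists c, `|c| <= `|s h - s 0| /\
    G (s h *: u + (h *: v + x)) - G (s 0 *: u + (h *: v + x)) =
      (s h - s 0) * 'D_u G (c *: u + (s 0 *: u + (h *: v + x))).
  move=> h; have [c ? E] := MVT_line (s 0 *: u + (h *: v + x)) (s h - s 0) du.
  exists c; split=> //.
  by rewrite -E [(s h - s 0) *: u + _]addrA -scalerDl subrK.
exists (fun h => 'D_u G (C h *: u + (s 0 *: u + (h *: v + x)))); last first.
  by move=> h; rewrite (HC h).2.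
have C0 : C h @[h --> 0] --> 0.
  apply/norm_cvg0P.
  apply: (@squeeze_cvgr _ _ _ _ (cst 0) (fun h => `|s h - s 0|)).
  - by near=> h; rewrite normr_ge0 (HC h).1.
  - exact: cvg_cst.
  - apply/norm_cvg0P; have := cvgB cs (cvg_cst (s 0)); rewrite subrr.
    exact.
have -> : s 0 *: u + x = 0 *: u + (s 0 *: u + (0 *: v + x)).
  by rewrite !scale0r !add0r.
apply: (@cvg_comp _ _ _ (fun h => C h *: u + (s 0 *: u + (h *: v + x)))
  ('D_u G)); last exact: cu.
apply: cvgD; first by apply: cvgZr_tmp.
apply: cvgD; first exact: cvg_cst.
apply: cvgD; last exact: cvg_cst.
by apply: cvgZr_tmp.
Unshelve. all: by end_near. Qed.

Lemma is_derive_along (R : realType) (V : normedModType R) (G : V -> R)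
    (s : R -> R) (u v x : V) (ds : R) : (forall y, derivable G y u) ->
  continuous ('D_u G) -> derivable G (s 0 *: u + x) v ->
  is_derive (0 : R) 1 s ds ->
  is_derive (0 : R) 1 (fun h : R => G (s h *: u + (h *: v + x)))
    ('D_u G (s 0 *: u + x) * ds + 'D_v G (s 0 *: u + x)).
Proof.
move=> du cu dv Ds.
have cs : {for 0, continuous s}.
  apply/differentiable_continuous/derivable1_diffP.
  exact: (@ex_derive _ _ _ _ _ _ _ Ds).
have [W W0 HW] := increment_along v x du cu cs.
apply/is_deriveP.
have -> : (fun h : R => h^-1 *
      (G (s (h *: (1 : R) + 0) *: u + ((h *: (1 : R) + 0) *: v + x)) -
       G (s 0 *: u + (0 *: v + x)))) =
    (fun h : R => W h * (h^-1 * (s (h *: (1 : R) + 0) - s 0)) +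
      h^-1 * (G (h *: v + (s 0 *: u + x)) - G (s 0 *: u + x))).
  apply/funext => h; rewrite scale0r add0r.
  have -> : h *: (1 : R) + 0 = h by rewrite addr0 [_ *: 1]mulr1.
  rewrite mulrCA [W h * _]mulrC -HW -mulrDr.
  by rewrite [h *: v + (s 0 *: u + x)]addrCA subrKA.
have W0' : W h @[h --> 0^'] --> 'D_u G (s 0 *: u + x).
  by apply: cvg_trans W0; apply: cvg_app; exact: nbhs_dnbhs.
have HG := (is_deriveP G (s 0 *: u + x) v _).2 (derivableP dv).
exact: (cvgD (cvgM W0' ((is_deriveP s 0 1 ds).2 Ds)) HG).
Qed.

(** Along a level curve the increment of [G] vanishes, so its [u]-part
    [(s h - s 0) * W h] cancels its [v]-part; dividing by [W h], which has a
    nonzero limit, differentiates [s]. *)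
Lemma is_derive_implicit (R : realType) (V : normedModType R) (G : V -> R)
    (s : R -> R) (u v x : V) : (forall y, derivable G y u) ->
  continuous ('D_u G) -> derivable G (s 0 *: u + x) v ->
  'D_u G (s 0 *: u + x) != 0 -> {for 0, continuous s} ->
  (\forall h \near 0, G (s h *: u + (h *: v + x)) = G (s 0 *: u + x)) ->
  is_derive (0 : R) 1 s (- ('D_v G (s 0 *: u + x) / 'D_u G (s 0 *: u + x))).
Proof.
move=> du cu dv D0 cs Gc.
have [W W0 HW] := increment_along v x du cu cs.
apply/is_deriveP.
have H : - (h^-1 * (G (h *: v + (s 0 *: u + x)) - G (s 0 *: u + x)) / W h)
    @[h --> 0^'] --> - ('D_v G (s 0 *: u + x) / 'D_u G (s 0 *: u + x)).
  have W0' : W h @[h --> 0^'] --> 'D_u G (s 0 *: u + x).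
    by apply: cvg_trans W0; apply: cvg_app; exact: nbhs_dnbhs.
  have HG := (is_deriveP G (s 0 *: u + x) v _).2 (derivableP dv).
  exact: (cvgN (cvgM HG (cvgV D0 W0'))).
apply: cvg_trans H; apply: near_eq_cvg.
have Wn : \forall h \near 0, W h != 0 by exact: (cvgr_neq0 _ W0 D0).
apply: nbhs_dnbhs; near=> h.
have -> : h *: (1 : R) + 0 = h by rewrite addr0 [_ *: 1]mulr1.
have Wh : W h != 0 by near: h.
have := HW h; rewrite (near Gc h)// => E.
rewrite [h *: v + (s 0 *: u + x)]addrCA -mulNr -mulrN opprB E.
by rewrite mulrA mulfK.
Unshelve. all: by end_near. Qed.

(** * Mixed partial derivatives commute *)

Lemma partials_cons (R : realType) n i (s : seq 'I_n) (f : 'rV[R]_n -> R) :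
  partials (i :: s) f = partial i (partials s f).
Proof. by []. Qed.

Section mixed_partials.
Variables (R : realType) (n : nat) (nu : mindex n) (f : 'rV[R]_n -> R).
Hypothesis fnu : Cmi nu f.

Let ok (s : seq 'I_n) := forall i, (count_mem i s <= nu i)%N.

Let ok_cons j s : ok (j :: s) -> ok s.
Proof. by move=> js i; apply: leq_trans (js i); rewrite /= leq_addl. Qed.

Let ok_lt j s : ok (j :: s) -> (count_mem j s < nu j)%N.
Proof. by move=> /(_ j); rewrite /= eqxx. Qed.

Lemma partials_cons_cat i p q : ok (i :: p ++ q) ->
  partials (p ++ i :: q) f = partials (i :: p ++ q) f.
Proof.
elim: p => [//|j p IH] okij.
have okji : ok (j :: i :: p ++ q).
  by move=> k; have := okij k; rewrite /= addnCA.
rewrite /= in okij; have okj := ok_cons okij; have oki := ok_cons okji.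
rewrite cat_cons partials_cons (IH oki).
change (partial j (partial i (partials (p ++ q) f)) =
  partial i (partial j (partials (p ++ q) f))).
have okpq := ok_cons oki.
apply: derive_swap.
- exact: (fnu okpq).2 (ok_lt oki).
- exact: (fnu okpq).2 (ok_lt okj).
- exact: (fnu oki).2 (ok_lt okji).
- exact: (fnu okj).2 (ok_lt okij).
- exact: (fnu okji).1.
- exact: (fnu okij).1.
Qed.

Lemma perm_partials s1 s2 : ok s1 -> perm_eq s1 s2 ->
  partials s1 f = partials s2 f.
Proof.
elim: s1 s2 => [|i s1 IH] s2 ok1 e12.
  by move: e12; rewrite perm_sym => /perm_nilP ->.
have : i \in s2 by rewrite -(perm_mem e12) mem_head.
move=> i2; case/path.splitPr: i2 e12 => p q e12.
have e1 : perm_eq s1 (p ++ q).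
  by rewrite -(perm_cons i) (perm_trans e12)// (perm_catCA p [:: i] q).
have okpq : ok (i :: p ++ q).
  by move=> k; rewrite -(permP (_ : perm_eq (i :: s1) _))// perm_cons.
rewrite (partials_cons_cat okpq).
by rewrite !partials_cons (IH (p ++ q) (ok_cons ok1) e1).
Qed.


End mixed_partials.

(** * The root of phi(., y) = t as a function of y *)

Lemma consr_line (R : realType) n (s h : R) (i : 'I_n) (y : 'rV[R]_n) :
  consr s (h *: delta_mx ord0 i + y) =
  s *: delta_mx ord0 ord0 +
    (h *: delta_mx ord0 (lift ord0 i) + consr 0 y).
Proof.
apply/rowP => j; rewrite !mxE eqxx /=; case: (unliftP ord0 j) => [k|] -> /=.
  by rewrite !mxE eqxx/= mulr0 add0r (inj_eq lift_inj).
by rewrite mulr1 mulr0 !addr0.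
Qed.

Lemma consr_axis (R : realType) n (s : R) (y : 'rV[R]_n) :
  consr s y = s *: delta_mx ord0 ord0 + consr 0 y.
Proof.
apply/rowP => j; rewrite !mxE eqxx /=; case: (unliftP ord0 j) => [k|] -> /=.
  by rewrite mulr0 add0r.
by rewrite mulr1 addr0.
Qed.

Lemma continuous_consr (R : realType) n (T : topologicalType) (s : T -> R)
    (f : T -> 'rV[R]_n) (x : T) :
  {for x, continuous s} -> {for x, continuous f} ->
  {for x, continuous (fun z => consr (s z) (f z))}.
Proof.
move=> cs cf; apply/cvg_ballP => e e0.
have /cvg_ballP/(_ e e0) Hs := cs.
have /cvg_ballP/(_ e e0) Hf := cf.
near=> z.
have Hsz : ball (s x) e (s z) by near: z.
have Hfz : ball (f x) e (f z) by near: z.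
case: Hfz => _ Hfz; split=> // i j; rewrite !mxE.
by case: (unliftP ord0 j) => [k|] _ /=.
Unshelve. all: by end_near. Qed.

Section level_set.
Variables (R : realType) (d : nat) (phi : 'rV[R]_d.+1 -> R) (t : R).
Hypothesis cphi : continuous phi.
Hypothesis dphi : forall x, derivable phi x (delta_mx ord0 ord0).
Hypothesis phi_pos : forall x, 0 < partial ord0 phi x.

Lemma phi_incr y (s s' : R) : s < s' -> phi (consr s y) < phi (consr s' y).
Proof.
move=> ss'; rewrite -subr_gt0.
have [c _] := MVT_line (consr s y) (s' - s) dphi.
have -> : (s' - s) *: delta_mx ord0 ord0 + consr s y = consr s' y.
  by rewrite (consr_axis s) addrA -scalerDl subrK -consr_axis.
move=> ->; rewrite pmulr_rgt0 ?subr_gt0//; exact: phi_pos.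
Qed.

Lemma xiP y : U phi t y -> phi (consr (xi phi t y) y) = t.
Proof.
move=> [y0 Hy0]; have := @getPex _ [set y0 | phi (consr y0 y) = t].
by apply; exists y0.
Qed.

Lemma xi_between y (s s' : R) : U phi t y ->
  phi (consr s y) < t -> t < phi (consr s' y) -> s < xi phi t y < s'.
Proof.
move=> /xiP E h h'.
have le_phi (a b : R) : a <= b -> phi (consr a y) <= phi (consr b y).
  by rewrite le_eqVlt => /orP[/eqP->//|/phi_incr/ltW].
apply/andP; split; rewrite ltNge; apply/negP => /le_phi.
  by rewrite E leNgt h.
by rewrite E leNgt h'.
Qed.

(** Openness of the set of reachable [y] and continuity of the root come
    together: the strict inequalities at [xi - e] and [xi + e] persist nearby
    and trap a root by the intermediate value theorem. *)
Lemma near_level_set y (e : R) : U phi t y -> 0 < e ->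
  \forall z \near y, U phi t z /\ `|xi phi t z - xi phi t y| < e.
Proof.
move=> Uy e0; set s := xi phi t y.
have cy (a : R) : {for y, continuous (fun z => phi (consr a z))}.
  apply: continuous_comp; last exact: cphi.
  by apply: continuous_consr; [exact: cst_continuous|move=> A].
have H1 : \forall z \near y, phi (consr (s - e) z) < t.
  apply: (cvgr_lt _ (cy (s - e))).
  by rewrite -(xiP Uy); apply: phi_incr; rewrite ltrBlDr ltrDl.
have H2 : \forall z \near y, phi (consr (s + e) z) > t.
  apply: (cvgr_gt _ (cy (s + e))).
  by rewrite -{1}(xiP Uy); apply: phi_incr; rewrite ltrDl.
near=> z.
have h1 : phi (consr (s - e) z) < t by near: z.
have h2 : phi (consr (s + e) z) > t by near: z.
have Uz : U phi t z.
  have sse : s - e <= s + e by rewrite lerBlDr -addrA lerDl addr_ge0// ltW.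
  have cz : {within `[s - e, s + e], continuous (fun a => phi (consr a z))}.
    apply: continuous_subspaceT => a.
    apply: continuous_comp; last exact: cphi.
    by apply: continuous_consr; [exact: cvg_id|exact: cvg_cst].
  have [|c _ Hc] := IVT sse cz (v := t); last by exists c.
  by rewrite ge_min le_max (ltW h1) (ltW h2) orbT.
split=> //; have := xi_between Uz h1 h2.
by rewrite ltr_distl.
Unshelve. all: by end_near. Qed.

Lemma open_U : open (U phi t).
Proof.
rewrite openE => y Uy; rewrite /interior.
by apply: (@filterS _ (nbhs y) _ _ _ _ (near_level_set Uy ltr01)) => z [].
Qed.

Lemma continuous_xi y : U phi t y -> {for y, continuous (xi phi t)}.
Proof.
move=> Uy; apply/(@cvgrPdist_lt _ _ _ (nbhs y)) => e e0.
apply: (@filterS _ (nbhs y) _ _ _ _ (near_level_set Uy e0)) => z [_].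
by rewrite distrC.
Qed.

Definition xi_pt y := consr (xi phi t y) y.

Lemma continuous_xi_pt y : U phi t y -> {for y, continuous xi_pt}.
Proof.
by move=> Uy; apply: continuous_consr; [exact: continuous_xi|move=> A].
Qed.

Section along_axis.
Variables (i : 'I_d) (y : 'rV[R]_d).
Hypothesis Uy : U phi t y.
Let s (h : R) := xi phi t (h *: delta_mx ord0 i + y).
Let e0 : 'rV[R]_d.+1 := delta_mx ord0 ord0.
Let ei : 'rV[R]_d.+1 := delta_mx ord0 (lift ord0 i).

Let s0 : s 0 = xi phi t y.
Proof. by rewrite /s scale0r add0r. Qed.

Let s0E : s 0 *: e0 + consr 0 y = xi_pt y.
Proof. by rewrite s0 -consr_axis. Qed.

Let line_cvg : (h *: delta_mx ord0 i + y : 'rV[R]_d) @[h --> (0 : R)] --> y.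
Proof.
have : (h *: delta_mx ord0 i + y : 'rV[R]_d) @[h --> (0 : R)] -->
    (0 : R) *: delta_mx ord0 i + y.
  by apply: cvgD; [apply: cvgZr_tmp; exact: cvg_id|exact: cvg_cst].
by rewrite scale0r add0r.
Qed.

Let cs : {for 0, continuous s}.
Proof.
have : s h @[h --> (0 : R)] --> xi phi t y.
  exact: (cvg_comp _ _ line_cvg (continuous_xi Uy)).
by rewrite -s0.
Qed.

Hypothesis cphi0 : continuous (partial ord0 phi).

Lemma is_derive_xi : derivable phi (xi_pt y) ei ->
  is_derive y (delta_mx ord0 i) (xi phi t)
    (- (partial (lift ord0 i) phi (xi_pt y) / partial ord0 phi (xi_pt y))).
Proof.
move=> dv; have -> : y = 0 *: delta_mx ord0 i + y by rewrite scale0r add0r.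
apply/is_derive_line; rewrite scale0r add0r -s0E.
have dv' : derivable phi (s 0 *: e0 + consr 0 y) ei by rewrite s0E.
apply: (is_derive_implicit dphi cphi0 dv' _ cs).
  by apply: lt0r_neq0; exact: phi_pos.
have HU := line_cvg (open_nbhs_nbhs (conj open_U Uy)).
move: HU; apply: (@filterS _ (nbhs (0 : R))) => h Uh.
by rewrite s0E (xiP Uy) -consr_line (xiP Uh).
Qed.

Lemma is_derive_xi_pt (G : 'rV[R]_d.+1 -> R) (dxi : R) :
  (forall x, derivable G x e0) -> continuous (partial ord0 G) ->
  derivable G (xi_pt y) ei -> is_derive y (delta_mx ord0 i) (xi phi t) dxi ->
  is_derive y (delta_mx ord0 i) (G \o xi_pt)
    (partial ord0 G (xi_pt y) * dxi + partial (lift ord0 i) G (xi_pt y)).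
Proof.
move=> du cu dv; have {1 2}-> : y = 0 *: delta_mx ord0 i + y.
  by rewrite scale0r add0r.
move=> /is_derive_line Ds; apply/is_derive_line; rewrite -s0E.
have := is_derive_along du cu (_ : derivable G (s 0 *: e0 + consr 0 y) ei) Ds.
rewrite s0E => /(_ dv); under eq_fun do rewrite -consr_line.
exact.
Qed.

End along_axis.

End level_set.

(** * Multi-indices *)

Definition madd n (eta : mindex n) (i : 'I_n) : mindex n :=
  [ffun j => eta j + (j == i)]%N.

Lemma mleP n (eta nu : mindex n) :
  reflect (forall i, eta i <= nu i)%N (mle eta nu).
Proof. exact: forallP. Qed.

Lemma mle_trans n (a b c : mindex n) : mle a b -> mle b c -> mle a c.
Proof.
by move=> /mleP ab /mleP bc; apply/mleP => i; exact: leq_trans (bc i).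
Qed.

Lemma mle_madd n (eta : mindex n) i : mle eta (madd eta i).
Proof. by apply/mleP => j; rewrite ffunE leq_addr. Qed.

Lemma mnorm_mle n (eta nu : mindex n) : mle eta nu -> (mnorm eta <= mnorm nu)%N.
Proof. by move=> /mleP h; apply: leq_sum. Qed.

Lemma mnorm_madd n (eta : mindex n) i : mnorm (madd eta i) = (mnorm eta).+1.
Proof.
rewrite /mnorm; under eq_bigr do rewrite ffunE.
rewrite big_split/= -[RHS]addn1; congr addn.
by rewrite (bigD1 i)//= eqxx big1 ?addn0// => j /negPf->.
Qed.

Lemma count_mderive_seq n (eta : mindex n) i :
  count_mem i (flatten [seq nseq (eta j) j | j <- enum 'I_n]) = eta i.
Proof.
rewrite count_flatten -map_comp sumnE big_map big_enum/=.
rewrite (bigD1 i)//= big1 ?addn0; last first.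
  by move=> j ji; rewrite count_nseq/= (negPf ji).
by rewrite count_nseq/= eqxx mul1n.
Qed.

Lemma mderive_munit (R : realType) n i (f : 'rV[R]_n -> R) :
  mderive (munit i) f = partial i f.
Proof.
rewrite /mderive.
suff -> : flatten [seq nseq (munit i j) j | j <- enum 'I_n] = [:: i] by [].
apply: perm_small_eq => //; apply/allP => j _ /=.
by rewrite count_mderive_seq ffunE addn0 (eq_sym i j).
Qed.

Section mderive_theory.
Variables (R : realType) (n : nat) (nu : mindex n) (f : 'rV[R]_n -> R).
Hypothesis fnu : Cmi nu f.

Let ok alpha : mle alpha nu -> forall i, (count_mem i
  (flatten [seq nseq (alpha j) j | j <- enum 'I_n]) <= nu i)%N.
Proof. by move=> /mleP h i; rewrite count_mderive_seq. Qed.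

Lemma continuous_mderive alpha : mle alpha nu -> continuous (mderive alpha f).
Proof. by move=> h; apply: (fnu (ok h)).1. Qed.

Lemma derivable_mderive alpha i x : mle (madd alpha i) nu ->
  derivable (mderive alpha f) x (delta_mx ord0 i).
Proof.
move=> h; have h' := mle_trans (mle_madd alpha i) h.
apply: (fnu (ok h')).2; rewrite count_mderive_seq.
by move: h => /mleP/(_ i); rewrite ffunE eqxx addn1.
Qed.

Lemma partial_mderive alpha i : mle (madd alpha i) nu ->
  partial i (mderive alpha f) = mderive (madd alpha i) f.
Proof.
move=> h; rewrite /mderive -partials_cons.
have p : perm_eq (i :: flatten [seq nseq (alpha j) j | j <- enum 'I_n])
    (flatten [seq nseq (madd alpha i j) j | j <- enum 'I_n]).
  apply/allP => j _ /=.
  by rewrite !count_mderive_seq ffunE addnC (eq_sym i j).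
apply: (perm_partials fnu) p => j.
rewrite /= count_mderive_seq addnC (eq_sym i j).
by move: h => /mleP/(_ j); rewrite ffunE.
Qed.

End mderive_theory.

(** * Functions of type (1, eta) *)

(** A term [(beta, s)] stands for [rho0^(beta)(xi) / D^0 phi] times the product
    over [s] of the quotients [- D^alpha phi / D^0 phi]. Spreading the sign and
    the power of [D^0 phi] over the factors in this way lets each factor be
    differentiated on its own. *)
Definition term (d : nat) : Type := nat * seq (mindex d.+1).

Section terms.
Variables (R : realType) (d : nat) (phi : 'rV[R]_d.+1 -> R) (rho0 : R -> R).
Variables (nu : mindex d) (t : R).
Let nu' := mcons (mnorm nu).+1 nu.
Hypothesis phi_pos : forall x, 0 < partial ord0 phi x.
Hypothesis phiC : Cmi nu' phi.
Hypothesis rhoC : Ck (mnorm nu) rho0.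

Local Notation X := (xi_pt phi t).
Local Notation e0 := (munit (ord0 : 'I_d.+1)).

Definition quot (alpha : mindex d.+1) (x : 'rV[R]_d.+1) : R :=
  - (mderive alpha phi x / partial ord0 phi x).

Definition term_fun (T : term d) (y : 'rV[R]_d) : R :=
  derive1n T.1 rho0 (xi phi t y) / partial ord0 phi (X y) *
  \prod_(alpha <- T.2) quot alpha (X y).

(** Differentiating one quotient along [y_i] gives four products: two from its
    numerator, two from its denominator, each time directly or through [xi],
    whose derivative is itself the quotient of [D^i phi]. *)
Fixpoint dquots (i : 'I_d) (s : seq (mindex d.+1)) : seq (seq (mindex d.+1)) :=
  if s is alpha :: s' then
    [:: madd alpha (lift ord0 i) :: s';
        madd alpha ord0 :: munit (lift ord0 i) :: s';
        alpha :: madd e0 (lift ord0 i) :: s';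
        alpha :: madd e0 ord0 :: munit (lift ord0 i) :: s'] ++
    [seq alpha :: l | l <- dquots i s']
  else [::].

Definition dterm (i : 'I_d) (T : term d) : seq (term d) :=
  (T.1.+1, munit (lift ord0 i) :: T.2) ::
  [seq (T.1, l) | l <-
     [:: madd e0 (lift ord0 i) :: T.2;
         madd e0 ord0 :: munit (lift ord0 i) :: T.2] ++ dquots i T.2].

Definition proper_index (m : nat) (alpha : mindex d.+1) : bool :=
  [&& alpha != munit ord0, alpha != mindex0 d.+1 & alpha ord0 <= m]%N.

Definition term_valid (eta : mindex d) (T : term d) : Prop :=
  [/\ (size T.2 <= 2 * mnorm eta)%N, all (proper_index (mnorm eta).+1) T.2,
      (T.1 <= mnorm eta)%N,
      (T.1 + \sum_(alpha <- T.2) alpha ord0 = size T.2)%N &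
      forall i, (\sum_(alpha <- T.2) alpha (lift ord0 i) = eta i)%N].

Lemma size_dquots i s : size (dquots i s) = (4 * size s)%N.
Proof. by elim: s => //= alpha s IH; rewrite size_map IH mulnS. Qed.

(** There are [3 + 4 r] new terms and [r <= 2 |eta|]; this is the growth that
    accumulates to [8 ^ |eta| * |eta|`!]. *)
Lemma size_dterm eta i T : term_valid eta T ->
  (size (dterm i T) <= 8 * (mnorm eta).+1)%N.
Proof. by case=> h _ _ _ _; rewrite /= size_map size_dquots; lia. Qed.

Lemma properW m (alpha : mindex d.+1) :
  proper_index m alpha -> proper_index m.+1 alpha.
Proof. by case/and3P=> ? ? ?; apply/and3P; split=> //; exact: leqW. Qed.

Lemma proper_madd_lift m (alpha : mindex d.+1) (i : 'I_d) :
  (alpha ord0 <= m)%N -> proper_index m (madd alpha (lift ord0 i)).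
Proof.
move=> h; apply/and3P; split.
- by apply/eqP => /ffunP/(_ (lift ord0 i)); rewrite !ffunE eqxx addn1.
- by apply/eqP => /ffunP/(_ (lift ord0 i)); rewrite !ffunE eqxx addn1.
- by rewrite ffunE addn0.
Qed.

Lemma proper_unit_lift m (i : 'I_d) : proper_index m (munit (lift ord0 i)).
Proof.
apply/and3P; split.
- by apply/eqP => /ffunP/(_ (lift ord0 i)); rewrite !ffunE eqxx.
- by apply/eqP => /ffunP/(_ (lift ord0 i)); rewrite !ffunE eqxx.
- by rewrite ffunE.
Qed.

Lemma proper_madd0 m (alpha : mindex d.+1) : alpha != mindex0 d.+1 ->
  (alpha ord0 <= m)%N -> proper_index m.+1 (madd alpha ord0).
Proof.
move=> h0 h; apply/and3P; split.
- apply: contra h0 => /eqP/ffunP E; apply/eqP/ffunP => j.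
  by have := E j; rewrite !ffunE; case: eqP => //= _; lia.
- by apply/eqP => /ffunP/(_ ord0); rewrite !ffunE eqxx addn1.
- by rewrite ffunE eqxx addn1.
Qed.

Lemma e0_neq0 : e0 != mindex0 d.+1.
Proof. by apply/eqP => /ffunP/(_ ord0); rewrite !ffunE eqxx. Qed.

Lemma proper_2e0 m : proper_index m.+2 (madd e0 ord0).
Proof. by apply: proper_madd0; [exact: e0_neq0|rewrite ffunE]. Qed.

(* The sums below mix [mindex] with its unfolding, which [lia] would take for
   distinct atoms. *)
Ltac mlia := unfold mindex in *; lia.

Lemma dquotsP m i s l : all (proper_index m) s -> (0 < m)%N ->
  l \in dquots i s ->
  [/\ (size l <= (size s).+2)%N, all (proper_index m.+1) l,
      (\sum_(alpha <- l) alpha ord0 + size s =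
         \sum_(alpha <- s) alpha ord0 + size l)%N &
      forall j, (\sum_(alpha <- l) alpha (lift ord0 j) =
         \sum_(alpha <- s) alpha (lift ord0 j) + (j == i))%N].
Proof.
move=> gs m0; case: m m0 gs => // m _.
elim: s l => [//|alpha s IH] l /= /andP[ga gs].
have gs' : all (proper_index m.+2) s by apply: sub_all gs => ?; exact: properW.
have ga' := properW ga; have /and3P[_ a0 am] := ga.
have E (j k : 'I_d) : (lift ord0 j == lift ord0 k) = (j == k :> 'I_d).
  by rewrite (inj_eq lift_inj).
have aux (u a b c e : nat) : (a + b = c + e -> u + a + b.+1 = u + c + e.+1)%N.
  by lia.
rewrite !inE => /or4P[/eqP->|/eqP->|/eqP->|/orP[/eqP->|]].
- split=> [|||j]; first by rewrite /= ltnS -addn2 leq_addr.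
  + by rewrite /= gs' (proper_madd_lift _ (leqW am)).
  + by rewrite !big_cons !ffunE /=; mlia.
  + by rewrite !big_cons !ffunE E; mlia.
- split=> [|||j]; first by rewrite /=.
  + by rewrite /= gs' proper_unit_lift proper_madd0.
  + by rewrite !big_cons !ffunE /=; mlia.
  + by rewrite !big_cons !ffunE E /=; mlia.
- split=> [|||j]; first by rewrite /=.
  + by rewrite /= gs' ga' proper_madd_lift// ffunE.
  + by rewrite !big_cons !ffunE /=; mlia.
  + by rewrite !big_cons !ffunE E /=; mlia.
- split=> [|||j]; first by rewrite /=.
  + by rewrite /= gs' ga' proper_unit_lift proper_2e0.
  + by rewrite !big_cons !ffunE /=; mlia.
  + by rewrite !big_cons !ffunE E /=; mlia.
- case/mapP => l' /(IH _ gs) [h1 h2 h3 h4] ->; split=> [|||j] //=.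
  + by rewrite ga'.
  + by rewrite !big_cons; exact: aux h3.
  + by rewrite !big_cons h4 addnA.
Qed.

(** With [is_derive_term], this is why [D^i] maps a function of type (1, eta) to
    a sum of functions of type (1, eta + e_i). *)
Lemma dterm_valid eta i T T' : term_valid eta T -> T' \in dterm i T ->
  term_valid (madd eta i) T'.
Proof.
case: T => beta s [/= h1 h2 h3 h4 h5].
have E (j k : 'I_d) : (lift ord0 j == lift ord0 k) = (j == k :> 'I_d).
  by rewrite (inj_eq lift_inj).
have gs : all (proper_index (mnorm eta).+2) s.
  by apply: sub_all h2 => ?; exact: properW.
rewrite inE => /orP[/eqP->|/mapP[l lin ->]].
  split=> [||||j] /=; rewrite ?mnorm_madd.
  - by mlia.
  - by rewrite gs proper_unit_lift.
  - by mlia.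
  - by rewrite big_cons !ffunE /=; mlia.
  - by rewrite big_cons !ffunE E h5 /= ?add0n addnC.
move: lin; rewrite mem_cat => /orP[|].
  rewrite !inE => /orP[] /eqP ->.
    split=> [||||j] /=; rewrite ?mnorm_madd.
    - by mlia.
    - by rewrite gs proper_madd_lift// ffunE.
    - by mlia.
    - by rewrite big_cons !ffunE /=; mlia.
    - by rewrite big_cons !ffunE E h5 /= ?add0n addnC.
  split=> [||||j] /=; rewrite ?mnorm_madd.
  - by mlia.
  - by rewrite gs proper_unit_lift proper_2e0.
  - by mlia.
  - by rewrite !big_cons !ffunE /=; mlia.
  - by rewrite !big_cons !ffunE E h5 /= ?add0n addnC.
move=> /(dquotsP h2 (ltn0Sn _))[g1 g2 g3 g4].
have aux (a b c e : nat) : (a + b = c + e -> beta + c = b -> beta + a = e)%N.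
  by lia.
split=> [||||j] /=; rewrite ?mnorm_madd //.
- by rewrite (leq_trans g1)// -add2n mulnS leq_add2l.
- exact: leqW.
- exact: aux g3 h4.
- by rewrite g4 h5 ffunE.
Qed.

End terms.

(** * Differentiating the functions of type (1, eta) *)

Section directional_calculus.
Variables (R : realType) (V : normedModType R) (x v : V).
Implicit Types f g : V -> R.

Lemma is_derive_mul f g (df dg : R) : is_derive x v f df ->
  is_derive x v g dg ->
  is_derive x v (fun y => f y * g y) (df * g x + f x * dg).
Proof.
move=> Hf Hg; have := is_deriveM Hf Hg.
by rewrite addrC [g x *: df]mulrC.
Qed.

Lemma is_derive_inv f (df : R) : f x != 0 -> is_derive x v f df ->
  is_derive x v (fun y => (f y)^-1) (- (df / f x) / f x).
Proof.
move=> fx [Hf <-]; split; first exact: derivableV.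
by rewrite deriveV// scaleNr mulNr [_ *: _]mulrC -exprVn expr2 mulrA.
Qed.

Lemma is_derive_opp f (df : R) : is_derive x v f df ->
  is_derive x v (fun y => - f y) (- df).
Proof. by move=> Hf; have := is_deriveN Hf. Qed.

Lemma is_derive_comp1 (h : R -> R) f (dh df : R) : is_derive (f x) 1 h dh ->
  is_derive x v f df -> is_derive x v (h \o f) (dh * df).
Proof.
have E : x = 0 *: v + x by rewrite scale0r add0r.
rewrite {1 2 3}E => Hh /is_derive_line Hf; apply/is_derive_line.
exact: is_derive1_comp Hh Hf.
Qed.

End directional_calculus.

Section terms.
Variables (R : realType) (d : nat) (phi : 'rV[R]_d.+1 -> R) (rho0 : R -> R).
Variables (nu : mindex d) (t : R).
Let nu' := mcons (mnorm nu).+1 nu.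
Hypothesis phi_pos : forall x, 0 < partial ord0 phi x.
Hypothesis phiC : Cmi nu' phi.
Hypothesis rhoC : Ck (mnorm nu) rho0.

Local Notation X := (xi_pt phi t).
Local Notation e0 := (munit (ord0 : 'I_d.+1)).
Local Notation quot := (quot phi).
Local Notation term_fun := (term_fun phi rho0 t).

Let nu'0 : nu' ord0 = (mnorm nu).+1.
Proof. by rewrite ffunE unlift_none. Qed.

Let nu'S i : nu' (lift ord0 i) = nu i.
Proof. by rewrite ffunE liftK. Qed.

Let mle_nu' (alpha : mindex d.+1) : (alpha ord0 <= (mnorm nu).+1)%N ->
  (forall i, alpha (lift ord0 i) <= nu i)%N -> mle alpha nu'.
Proof.
move=> h0 h; apply/mleP => j; case: (unliftP ord0 j) => [k|] ->.
  by rewrite nu'S.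
by rewrite nu'0.
Qed.

Let cphi : continuous phi.
Proof. by apply: (phiC (s := [::]) _).1. Qed.

Let dphi x : derivable phi x (delta_mx ord0 ord0).
Proof. by apply: (phiC (s := [::]) _).2 => //; rewrite nu'0. Qed.

Let e0_le : mle e0 nu'.
Proof. by apply: mle_nu' => [|i]; rewrite ffunE. Qed.

Let D0E : mderive e0 phi = partial ord0 phi.
Proof. exact: mderive_munit. Qed.

Let cphi0 : continuous (partial ord0 phi).
Proof. by rewrite -D0E; exact: continuous_mderive e0_le. Qed.

Let D0_neq0 x : partial ord0 phi x != 0.
Proof. exact: lt0r_neq0. Qed.

Section one_step.
Variables (eta : mindex d) (i : 'I_d).
Hypothesis eta_i : mle (madd eta i) nu.

Let eta_lt : (mnorm eta < mnorm nu)%N.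
Proof. by rewrite -(mnorm_madd eta i); exact: mnorm_mle. Qed.

Let nui : (0 < nu i)%N.
Proof.
by move/mleP/(_ i): eta_i; rewrite ffunE eqxx addn1; exact: leq_trans.
Qed.

Let le_nui j : ((j == i) <= nu j)%N.
Proof. by case: eqVneq => // ->. Qed.

Let ei := munit (lift (ord0 : 'I_d.+1) i).
Let vi : 'rV[R]_d := delta_mx ord0 i.

Let e0i_le : mle (madd e0 (lift ord0 i)) nu'.
Proof.
apply: mle_nu' => [|j]; rewrite !ffunE //=.
by rewrite add0n (inj_eq lift_inj).
Qed.

Let e00_le : mle (madd e0 ord0) nu'.
Proof.
apply: mle_nu' => [|j]; rewrite !ffunE //=.
by rewrite ltnS; exact: leq_ltn_trans eta_lt.
Qed.

Let is_derive_xiq y : U phi t y -> is_derive y vi (xi phi t) (quot ei (X y)).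
Proof.
move=> Uy; rewrite /quot mderive_munit; apply: is_derive_xi => //.
by apply: (phiC (s := [::]) _).2 => //; rewrite nu'S.
Qed.

Let is_derive_mderive alpha y : U phi t y -> mle (madd alpha ord0) nu' ->
  mle (madd alpha (lift ord0 i)) nu' ->
  is_derive y vi (fun y => mderive alpha phi (X y))
    (mderive (madd alpha ord0) phi (X y) * quot ei (X y) +
     mderive (madd alpha (lift ord0 i)) phi (X y)).
Proof.
move=> Uy h0 hi.
have du x : derivable (mderive alpha phi) x (delta_mx ord0 ord0).
  exact: (derivable_mderive phiC h0).
have dv : derivable (mderive alpha phi) (X y) (delta_mx ord0 (lift ord0 i)).
  exact: (derivable_mderive phiC hi).
have cu : continuous (partial ord0 (mderive alpha phi)).
  by rewrite (partial_mderive phiC h0); exact: continuous_mderive h0.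
have := is_derive_xi_pt du cu dv (is_derive_xiq Uy).
by rewrite (partial_mderive phiC h0) (partial_mderive phiC hi).
Qed.

(* The logarithmic derivative of [1 / D^0 phi] along the level set. *)
Let dlog y := quot (madd e0 (lift ord0 i)) (X y) +
  quot (madd e0 ord0) (X y) * quot ei (X y).

Let is_derive_invD0 y : U phi t y ->
  is_derive y vi (fun y => (partial ord0 phi (X y))^-1)
    (dlog y / partial ord0 phi (X y)).
Proof.
move=> Uy; have := is_derive_mderive Uy e00_le e0i_le; rewrite D0E.
move=> H; have := is_derive_inv (f := fun y => partial ord0 phi (X y))
  (D0_neq0 (X y)) H.
move=> /is_derive_eq; apply.
rewrite /dlog /quot; field; exact: D0_neq0.
Qed.

Let dquot alpha y := quot (madd alpha (lift ord0 i)) (X y) +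
  quot (madd alpha ord0) (X y) * quot ei (X y) + quot alpha (X y) * dlog y.

Let is_derive_quot alpha y : U phi t y -> mle (madd alpha ord0) nu' ->
  mle (madd alpha (lift ord0 i)) nu' ->
  is_derive y vi (fun y => quot alpha (X y)) (dquot alpha y).
Proof.
move=> Uy h0 hi.
have := is_derive_opp (is_derive_mul (is_derive_mderive Uy h0 hi)
  (is_derive_invD0 Uy)).
move=> /is_derive_eq; apply.
rewrite /dquot /dlog /quot; field; exact: D0_neq0.
Qed.

Let is_derive_quots s y : U phi t y ->
  (forall alpha, alpha \in s -> mle (madd alpha ord0) nu' /\
    mle (madd alpha (lift ord0 i)) nu') ->
  is_derive y vi (fun y => \prod_(alpha <- s) quot alpha (X y))
    (\sum_(l <- dquots i s) \prod_(alpha <- l) quot alpha (X y)).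
Proof.
move=> Uy; elim: s => [_|alpha s IH hs].
  under eq_fun do rewrite big_nil.
  rewrite big_nil; exact: is_derive_cst.
have [h0 hi] := hs alpha (mem_head _ _).
have IHs : is_derive y vi (fun y => \prod_(alpha <- s) quot alpha (X y))
    (\sum_(l <- dquots i s) \prod_(alpha <- l) quot alpha (X y)).
  by apply: IH => b bs; apply: hs; rewrite inE bs orbT.
under eq_fun do rewrite big_cons.
have := is_derive_mul (is_derive_quot Uy h0 hi) IHs.
move=> /is_derive_eq; apply.
have E : \sum_(l <- [seq alpha :: l | l <- dquots i s])
    \prod_(beta <- l) quot beta (X y) =
    quot alpha (X y) * \sum_(l <- dquots i s) \prod_(beta <- l) quot beta (X y).
  by rewrite big_map big_distrr/=; apply: eq_bigr => l _; rewrite big_cons.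
rewrite [dquots i (_ :: _)]/= !big_cons E /dquot /dlog.
move: (\prod_(_ <- s) _) (\sum_(_ <- _) _) => P S; ring.
Qed.

Lemma is_derive_term T y : U phi t y -> term_valid eta T ->
  is_derive y vi (term_fun T) (\sum_(T' <- dterm i T) term_fun T' y).
Proof.
case: T => beta s Uy [/= h1 h2 h3 h4 h5].
have hs alpha : alpha \in s -> mle (madd alpha ord0) nu' /\
    mle (madd alpha (lift ord0 i)) nu'.
  move=> als; have /and3P[_ _ a0] := allP h2 _ als.
  have aj j : (alpha (lift ord0 j) <= eta j)%N.
    by rewrite -h5 (big_rem _ als)/= leq_addr.
  have ej j : (eta j + (j == i) <= nu j)%N.
    by move/mleP/(_ j): eta_i; rewrite ffunE.
  split; apply: mle_nu' => [|j]; rewrite ffunE.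
  - by rewrite eqxx addn1 ltnS (leq_trans a0).
  - by rewrite addn0 (leq_trans (aj j))// (leq_trans _ (ej j))// leq_addr.
  - by rewrite addn0 (leq_trans a0)// ltnS ltnW.
  - by rewrite (inj_eq lift_inj) (leq_trans _ (ej j))// leq_add2r.
have Hrho : is_derive y vi (derive1n beta rho0 \o xi phi t)
    (derive1n beta.+1 rho0 (xi phi t y) * quot ei (X y)).
  apply: is_derive_comp1; last exact: is_derive_xiq.
  rewrite derive1nS derive1E; apply: derivableP.
  have bn : (beta < mnorm nu)%N by exact: leq_ltn_trans eta_lt.
  exact: (rhoC (ltnW bn)).2.
have := is_derive_mul (is_derive_mul Hrho (is_derive_invD0 Uy))
  (is_derive_quots Uy hs).
move=> /is_derive_eq; apply.
have E : \sum_(l <- dquots i s) term_fun (beta, l) y =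
    derive1n beta rho0 (xi phi t y) / partial ord0 phi (X y) *
    \sum_(l <- dquots i s) \prod_(b <- l) quot b (X y).
  by rewrite big_distrr.
rewrite /dterm map_cat big_cons big_cat big_map /= !big_cons big_nil big_map E.
rewrite /term_fun /= !big_cons /dlog.
move: (\prod_(_ <- s) _) (\sum_(_ <- _) _) => P S; ring.
Qed.

End one_step.
End terms.

(** * Extension by zero across the boundary *)

Section extension_by_zero.
Variables (R : realType) (V : normedModType R) (f g : V -> R) (v : V).
Variable W : set V.
Hypotheses (Wo : open W) (cf : continuous f) (cg : continuous g).
Hypotheses (f0 : forall y, ~ W y -> f y = 0) (g0 : forall y, ~ W y -> g y = 0).
Hypothesis fg : forall y, W y -> is_derive y v f (g y).

(** Between the last point of the segment outside [W] and its end, the mean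
    value theorem applies, and [f] vanishes at that last point. *)
Lemma bound_from_outside y (h e : R) : ~ W y -> 0 <= e ->
  (forall s, 0 <= s <= 1 -> `|g ((s * h) *: v + y)| <= e) ->
  `|f (h *: v + y)| <= e * `|h|.
Proof.
move=> nWy e0 ge.
have [Wh|nWh] := pselect (W (h *: v + y)); last first.
  by rewrite f0// normr0 mulr_ge0.
pose p (s : R) := (s * h) *: v + y.
have cp : continuous p.
  move=> s; apply: cvgD; last exact: cvg_cst.
  by apply: cvgZr_tmp; exact: mulrr_continuous.
pose A := [set s : R | 0 <= s <= 1 /\ ~ W (p s)].
have A0 : A 0 by split; rewrite ?lexx ?ler01// /p mul0r scale0r add0r.
have supA : has_sup A.
  by split; [exists 0|exists 1 => s [] /andP[]].
have clA : closed A.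
  rewrite [A](_ : _ = `[0, 1]%classic `&` ~` (p @^-1` W)).
    apply: closedI; first exact: interval_closed.
    by apply: open_closedC; apply: open_comp => // s _; exact: cp.
  by apply/seteqP; split=> s /=; rewrite in_itv/=.
pose b := sup A.
have Ab : A b by apply: clA; apply: closure_sup; [exists 0|exact: supA.2].
have [/andP[b0 b1] nWb] := Ab.
have {}b1 : b < 1.
  rewrite lt_neqAle b1 andbT; apply/eqP => b1'.
  by apply: nWb; rewrite b1' /p mul1r.
have dk s : s \in `]b, 1[%R -> is_derive s 1 (fun s => f (p s)) (g (p s) * h).
  rewrite in_itv/= => /andP[bs s1].
  have Ws : W (p s).
    apply: contrapT => nWs; have : s <= b.
      apply: ub_le_sup => //; first exact: (supA.2).
      by split=> //; rewrite (ltW (le_lt_trans b0 bs)) ltW.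
    by rewrite leNgt bs.
  have /is_derive_line H := fg Ws.
  have M : is_derive s 1 ( *%R^~ h) h.
    have := is_derive_mul (is_derive_id s (1 : R)) (is_derive_cst h s (1 : R)).
    by rewrite mulr0 addr0 mul1r.
  exact: (@is_derive1_comp _ (fun r => f (r *: v + y)) ( *%R^~ h) s _ _ H M).
have ck : {within `[b, 1], continuous (fun s => f (p s))}.
  apply: continuous_subspaceT => s.
  by apply: continuous_comp; [exact: cp|exact: cf].
have [c] := MVT b1 dk ck; rewrite in_itv/= => /andP[bc c1].
rewrite (f0 nWb) subr0 /p mul1r => ->.
rewrite !normrM -mulrA ler_pM//.
  by apply: ge; rewrite !ltW// (le_lt_trans b0).
by rewrite ler_piMr// ger0_norm ?subr_ge0 ?(ltW b1)// lerBlDr lerDl.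
Qed.

(** Outside [W] the difference quotient of [f] is bounded by nearby values of
    [g], which tend to 0. *)
Lemma is_derive_extension y : is_derive y v f (g y).
Proof.
have [|nWy] := pselect (W y); first exact: fg.
rewrite (g0 nWy); apply/is_deriveP/cvgrPdist_le => e e0.
have [d d0 gd] := near_plane v 0 (@cg y) e0.
have : \forall h \near (0 : R), `|h| <= d.
  apply/nbhs_ballP; exists d => // h.
  by rewrite -ball_normE /= sub0r normrN => /ltW.
move=> hd; apply: nbhs_dnbhs; near=> h.
rewrite sub0r normrN normrM (f0 nWy) subr0.
have [->|h0] := eqVneq h 0; first by rewrite invr0 normr0 mul0r ltW.
rewrite normfV ler_pdivrMl ?normr_gt0// mulrC.
apply: bound_from_outside => //; first exact: ltW.
move=> s /andP[s0 s1].
have shd : `|s * h| <= d.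
  rewrite normrM (le_trans _ (near hd h _))// ler_piMl//.
  by rewrite ger0_norm.
have := gd (s * h) 0 shd; rewrite normr0 => /(_ (ltW d0)).
by rewrite scaler0 add0r (g0 nWy) subr0 => /ltW.
Unshelve. all: by end_near. Qed.

End extension_by_zero.

(** * Mixed partial derivatives of the preintegral *)

Definition mcount n (s : seq 'I_n) : mindex n := [ffun i => count_mem i s].
Lemma mcount_cons n (i : 'I_n) s : mcount (i :: s) = madd (mcount s) i.
Proof. by apply/ffunP => j; rewrite !ffunE /= addnC (eq_sym i). Qed.

Lemma mnorm_mcount n (s : seq 'I_n) : mnorm (mcount s) = size s.
Proof.
elim: s => [|i s IH]; last by rewrite mcount_cons mnorm_madd IH.
by rewrite /mnorm big1// => i _; rewrite ffunE.
Qed.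

Section preintegration.
Variables (R : realType) (d : nat) (phi : 'rV[R]_d.+1 -> R) (rho0 : R -> R).
Variables (rho psi : 'I_d -> R -> R) (nu : mindex d) (a b t : R).
Variable B : mindex d -> R.
Let nu' := mcons (mnorm nu).+1 nu.
Hypothesis phi_pos : forall x, 0 < partial ord0 phi x.
Hypothesis phiC : Cmi nu' phi.
Hypothesis rhoC : Ck (mnorm nu) rho0.
Hypothesis decay : forall eta, mle eta nu ->
  decay_condition phi rho0 rho psi 1 eta a b (B eta).
Hypothesis tab : t \in `[a, b].

Local Notation X := (xi_pt phi t).
Local Notation term_fun := (term_fun phi rho0 t).

Let nu'0 : nu' ord0 = (mnorm nu).+1.
Proof. by rewrite ffunE unlift_none. Qed.

Let nu'S (i : 'I_d) : nu' (lift ord0 i) = nu i.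
Proof. by rewrite ffunE liftK. Qed.

Let cphi : continuous phi.
Proof. by apply: (phiC (s := [::]) _).1. Qed.

Let dphi x : derivable phi x (delta_mx ord0 ord0).
Proof. by apply: (phiC (s := [::]) _).2 => //; rewrite nu'0. Qed.

Let cphi0 : continuous (partial ord0 phi).
Proof.
apply: (phiC (s := [:: ord0]) _).1 => i /=; rewrite addn0.
by case: eqVneq => // <-; rewrite nu'0.
Qed.

Let oU : open (U phi t).
Proof. exact: open_U. Qed.

Definition term_ext (T : term d) (y : 'rV[R]_d) : R :=
  if y \in U phi t then term_fun T y else 0.

Lemma term_ext_in T y : U phi t y -> term_ext T y = term_fun T y.
Proof. by move=> Uy; rewrite /term_ext mem_set. Qed.

Lemma term_ext_out T y : ~ U phi t y -> term_ext T y = 0.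
Proof. by move=> Uy; rewrite /term_ext memNset. Qed.

Lemma prod_quotE s x : \prod_(alpha <- s) quot phi alpha x =
  (-1) ^+ size s * (\prod_(alpha <- s) mderive alpha phi x) /
  partial ord0 phi x ^+ size s.
Proof.
elim: s => [|alpha s IH]; first by rewrite !big_nil /= !expr0 mulr1 divr1.
rewrite !big_cons IH /= !exprS invfM /quot.
move: (\prod_(_ <- s) _) (_ ^+ size s) => P S; ring.
Qed.

Lemma term_type_fun eta T : term_valid eta T ->
  exists r (alpha : 'I_r -> mindex d.+1) beta,
    type_params 1 eta alpha beta /\
    type_fun phi rho0 1 alpha beta t = term_fun T.
Proof.
case: T => beta s [/= h1 h2 h3 h4 h5].
exists (size s), (tnth (in_tuple s)), beta; split.
  have hs l : proper_index (mnorm eta).+1 (tnth (in_tuple s) l).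
    by apply: (allP h2); exact: mem_tnth.
  split.
  - by rewrite addn1 ltnS.
  - by move=> l; have /and3P[] := hs l.
  - by move=> l; have /and3P[_ _] := hs l; rewrite addn1.
  - by rewrite addn1 ltnS.
  - split=> [|i].
      rewrite -(big_tnth _ _ s xpredT (fun alpha : mindex d.+1 => alpha ord0)).
      by rewrite addSn h4 addn1.
    by rewrite -(big_tnth _ _ s xpredT
      (fun alpha : mindex d.+1 => alpha (lift ord0 i))) h5.
apply/funext => y; rewrite /type_fun /term_fun prod_quotE /=.
rewrite -(big_tnth _ _ s xpredT (fun alpha => mderive alpha phi _)).
rewrite -/(xi_pt phi t y) addn1 exprSr invfM.
move: (\prod_(_ <- s) _) (derive1n _ _ _) => P S; ring.
Qed.

Lemma continuous_term eta T y : mle eta nu -> term_valid eta T -> U phi t y ->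
  {for y, continuous (term_fun T)}.
Proof.
case: T => beta s le_eta [/= h1 h2 h3 h4 h5] Uy.
have cX : {for y, continuous X} by exact: continuous_xi_pt.
have cc (G : 'rV[R]_d.+1 -> R) : continuous G ->
    {for y, continuous (fun z => G (X z))}.
  by move=> cG; apply: continuous_comp => //; exact: cG.
have cD0 : {for y, continuous (fun z => (partial ord0 phi (X z))^-1)}.
  exact: (cvgV (lt0r_neq0 (phi_pos (X y))) (cc _ cphi0)).
have cq alpha : alpha \in s ->
    {for y, continuous (fun z => quot phi alpha (X z))}.
  move=> als; have /and3P[_ _ a0] := allP h2 _ als.
  have le_alpha : mle alpha nu'.
    apply/mleP => j; case: (unliftP ord0 j) => [k|] ->.
      rewrite nu'S (leq_trans _ (mleP _ _ le_eta k))//.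
      by rewrite -h5 (big_rem _ als)/= leq_addr.
    by rewrite nu'0 (leq_trans a0)// ltnS mnorm_mle.
  exact: (cvgN (cvgM (cc _ (continuous_mderive phiC le_alpha)) cD0)).
have cP l : {subset l <= s} ->
    \prod_(alpha <- l) quot phi alpha (X z) @[z --> y] -->
    \prod_(alpha <- l) quot phi alpha (X y).
  elim: l => [_|alpha l IH hl].
    under eq_fun do rewrite big_nil; rewrite big_nil.
    exact: (@cvg_cst R 1 _ (nbhs y) _).
  under eq_fun do rewrite big_cons; rewrite big_cons.
  have IHl : {subset l <= s} by move=> c cl; apply: hl; rewrite inE cl orbT.
  exact: (cvgM (cq _ (hl _ (mem_head _ _))) (IH IHl)).
have cR : {for y, continuous (derive1n beta rho0 \o xi phi t)}.
  apply: continuous_comp; first exact: continuous_xi.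
  by apply: (rhoC _).1; rewrite (leq_trans h3)// mnorm_mle.
exact: (cvgM (cvgM cR cD0) (cP s (fun _ => id))).
Qed.

(** At the boundary of [U phi t], where the extension takes the value 0,
    continuity is what the decay condition says. *)
Lemma continuous_term_ext eta T : mle eta nu -> term_valid eta T ->
  continuous (term_ext T).
Proof.
move=> le_eta vT z; have [Uz|nUz] := pselect (U phi t z).
  rewrite /continuous_at (term_ext_in _ Uz).
  apply: cvg_trans (continuous_term le_eta vT Uz).
  have HU : nbhs z (U phi t) by exact: open_nbhs_nbhs.
  have H : {near z, term_fun T =1 term_ext T}.
    apply: (@filterS _ (nbhs z) _ _ _ _ HU) => y Uy.
    by rewrite /= term_ext_in.
  exact: (near_eq_cvg H).
rewrite /continuous_at (term_ext_out _ nUz).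
have [r [alpha [beta [pr E]]]] := term_type_fun vT.
have lim0 : term_fun T y @[y --> within (U phi t) (nbhs z)] --> (0 : R).
  have [clz|nclz] := pselect (closure (U phi t) z).
    rewrite -E; apply: (decay le_eta pr).1 => //.
    by split=> //; move=> /interior_subset.
  have out : nbhs z (~` U phi t).
    apply: contrapT => h; apply: nclz => A Az; apply: contrapT => h'.
    apply: h; apply: (@filterS _ (nbhs z) _ A) => // y Ay Uy; apply: h'.
    by exists y.
  apply: cvg_trans (cvg_cst (0 : R) (F := within (U phi t) (nbhs z))).
  have H : within (U phi t) (nbhs z) [set y | 0 = term_fun T y].
    by apply: (@filterS _ (nbhs z) _ _ _ _ out) => y nUy /nUy.
  exact: (near_eq_cvg H).
apply/(@cvgrPdist_lt _ _ _ (nbhs z)) => e e0.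
have /cvgrPdist_lt/(_ e e0) := lim0.
apply: (@filterS _ (nbhs z)) => y H.
have [Uy|nUy] := pselect (U phi t y).
  by rewrite term_ext_in//; exact: H.
by rewrite term_ext_out// subrr normr0.
Qed.

Lemma is_derive_term_ext eta i T y : mle (madd eta i) nu -> term_valid eta T ->
  is_derive y (delta_mx ord0 i) (term_ext T)
    (\sum_(T' <- dterm i T) term_ext T' y).
Proof.
move=> le_eta vT; have le_eta' := mle_trans (mle_madd eta i) le_eta.
apply: (@is_derive_extension R _ (term_ext T)
    (fun y => \sum_(T' <- dterm i T) term_ext T' y) _ _ oU).
- exact: continuous_term_ext vT.
- have : forall T', T' \in dterm i T -> term_valid (madd eta i) T'.
    by move=> T'; exact: dterm_valid.
  elim: (dterm i T) => [_|T' l IH hl].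
    under eq_fun do rewrite big_nil; exact: cst_continuous.
  under eq_fun do rewrite big_cons.
  have c1 : continuous (term_ext T').
    by apply: (continuous_term_ext le_eta); apply: hl; rewrite mem_head.
  have c2 : continuous (fun y => \sum_(T' <- l) term_ext T' y).
    by apply: IH => c cl; apply: hl; rewrite inE cl orbT.
  move=> z; exact: (cvgD (c1 z) (c2 z)).
- exact: term_ext_out.
- by move=> z nUz; rewrite big1// => T' _; exact: term_ext_out.
- move=> z Uz; have := is_derive_term phi_pos phiC rhoC le_eta Uz vT.
  under eq_bigr do rewrite -(term_ext_in _ Uz).
  have HU : nbhs z (U phi t) by exact: open_nbhs_nbhs.
  have H : nbhs z [set y | term_fun T y = term_ext T y].
    by apply: (@filterS _ (nbhs z) _ _ _ _ HU) => u Uu; rewrite /= term_ext_in.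
  exact: (near_eq_is_derive H).
Qed.

(** Each further derivative replaces every term by its [dterm], in the order in
    which [s] prescribes the derivatives; another order gives other terms of the
    same type. *)
Lemma partials_preint s : mle (mcount s) nu ->
  exists Ts : seq (term d), [/\ forall T, T \in Ts -> term_valid (mcount s) T,
    (0 < size Ts <= 8 ^ size s * (size s)`!)%N &
    partials s (preint_delta phi rho0 t) =
      (fun y => \sum_(T <- Ts) term_ext T y)].
Proof.
elim: s => [_|i s IH le_is].
  exists [:: (0%N, [::])]; split => //.
    move=> T /[!inE] /eqP ->; split => //=; first by rewrite big_nil.
    by move=> j; rewrite big_nil ffunE.
  apply/funext => y; rewrite big_seq1 /= /preint_delta /term_ext.
  by case: ifP => // _; rewrite /term_fun /= big_nil mulr1.
have le_is' : mle (madd (mcount s) i) nu by rewrite -mcount_cons.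
have [Ts [vTs /andP[Ts0 sTs] E]] := IH (mle_trans (mle_madd _ i) le_is').
exists (flatten [seq dterm i T | T <- Ts]); split.
- move=> T /flatten_mapP[T' T'Ts TT']; rewrite mcount_cons.
  exact: dterm_valid (vTs _ T'Ts) TT'.
- apply/andP; split; first by case: Ts Ts0 {vTs sTs E}.
  rewrite size_flatten /shape -map_comp sumnE big_map /=.
  have : (\sum_(T <- Ts) size (dterm i T) <= \sum_(T <- Ts) 8 * (size s).+1)%N.
    rewrite big_seq [leqRHS]big_seq; apply: leq_sum => T TTs.
    by rewrite -(mnorm_mcount s); apply: size_dterm; exact: vTs.
  rewrite big_const_seq count_predT iter_addn_0 => h.
  apply: leq_trans h _; rewrite factS expnS mulnACA.
  exact: leq_mul (leqnn _) sTs.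
- rewrite partials_cons E; apply/funext => y; apply: derive_val.
  rewrite big_flatten big_map /= {Ts0 sTs E}.
  elim: Ts vTs => [_|T Ts IHT vTs].
    under eq_fun do rewrite big_nil.
    rewrite big_nil; exact: is_derive_cst.
  under eq_fun do rewrite big_cons; rewrite big_cons.
  have dT := is_derive_term_ext y le_is' (vTs _ (mem_head _ _)).
  have dTs := IHT (fun T' hT' => vTs T' (@mem_behead _ (T :: Ts) _ hT')).
  exact: (is_deriveD dT dTs).
Qed.

Lemma Cmi_preint : Cmi nu (preint_delta phi rho0 t).
Proof.
move=> s hs; have le_s : mle (mcount s) nu.
  by apply/mleP => i; rewrite ffunE.
have [Ts [vTs _ E]] := partials_preint le_s.
split.
  rewrite E => y; elim: Ts {E} vTs => [_|T Ts IH vTs].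
    under eq_fun do rewrite big_nil; exact: cst_continuous.
  under eq_fun do rewrite big_cons.
  have c1 := continuous_term_ext le_s (vTs _ (mem_head _ _)).
  have c2 := IH (fun T' hT' => vTs T' (@mem_behead _ (T :: Ts) _ hT')).
  exact: (cvgD (c1 y) c2).
move=> i lt_i y; have le_is : mle (madd (mcount s) i) nu.
  apply/mleP => j; rewrite !ffunE; case: eqVneq => [->|_].
    by rewrite addn1.
  by rewrite addn0.
rewrite E; elim: Ts {E} vTs => [_|T Ts IH vTs].
  under eq_fun do rewrite big_nil; exact: derivable_cst.
under eq_fun do rewrite big_cons.
have dT := is_derive_term_ext y le_is (vTs _ (mem_head _ _)).
have dTs := IH (fun T' hT' => vTs T' (@mem_behead _ (T :: Ts) _ hT')).
exact: (derivableD (@ex_derive _ _ _ _ _ _ _ dT) dTs).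
Qed.

End preintegration.

(** * Borel sets and Lebesgue integrals on R^n *)

Section borel_rV.
Variables (R : realType) (n : nat).
Local Notation rV := ('rV[R]_n).

Lemma measurable_box (c : 'I_n -> set R) : (forall i, measurable (c i)) ->
  measurable [set y : rV | forall i, c i (y ord0 i)].
Proof.
move=> mc; rewrite [X in measurable X](_ : _ =
    \big[setI/setT]_(i < n) ((fun y : rV => y ord0 i) @^-1` c i)).
  apply: bigsetI_measurable => i _; rewrite -[X in measurable X]setTI.
  exact: measurable_coord.
apply/seteqP; split => y /=.
  by move=> cy; rewrite -bigcap_seq => i _; exact: cy.
by rewrite -bigcap_seq => cy i; apply: cy; rewrite /= mem_index_enum.
Qed.

(** The sigma-algebra on ['rV[R]_n] is generated by the coordinates; an open set
    belongs to it as a union of countably many rational cubes. *)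
Lemma open_measurable_rV (A : set rV) : open A -> measurable A.
Proof.
move=> oA.
pose c (p : 'rV[rat]_n * nat) (i : 'I_n) : set R :=
  `](ratr (p.1 ord0 i) - p.2.+1%:R^-1),
    (ratr (p.1 ord0 i) + p.2.+1%:R^-1)[%classic.
pose box p : set rV := [set y | forall i, c p i (y ord0 i)].
rewrite [A](_ : _ = \bigcup_p (if `[< box p `<=` A >] then box p else set0)).
  apply: countable_bigcupT_measurable => [|p]; first exact: countableP.
  case: ifP => // _.
  by apply: (@measurable_box (c p)) => i; exact: measurable_itv.
apply/seteqP; split => y; last first.
  by move=> [p _]; case: ifPn => // /asboolP; apply.
move=> Ay; have /nbhs_ballP[e /= e0 eA] : nbhs y A by exact: open_nbhs_nbhs.
have e20 : 0 < e / 2 by rewrite divr_gt0.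
have [k _ /(_ k (leqnn k)) /= ke] := near_infty_natSinv_lt (PosNum e20).
have k0 : 0 < k.+1%:R^-1 :> R by rewrite invr_gt0.
have /choice[q Hq] : forall i : 'I_n, exists q : rat,
    ratr q \in `](y ord0 i - k.+1%:R^-1), (y ord0 i + k.+1%:R^-1)[.
  move=> i; have [|q Hq] := @rat_in_itvoo R (y ord0 i - k.+1%:R^-1)
      (y ord0 i + k.+1%:R^-1); last by exists q.
  by rewrite ltrBlDr -addrA ltrDl addr_gt0.
have Hqi i : `|y ord0 i - ratr (q i)| < k.+1%:R^-1.
  by move: (Hq i); rewrite in_itv/= -ltr_distl distrC.
exists (\row_i q i, k) => //=.
rewrite ifT; last first.
  apply/asboolP => z bz; apply: eA; split=> // i j.
  rewrite (ord1 i) /ball/= -(subrKA (ratr (q j))).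
  rewrite (le_lt_trans (ler_normD _ _))// (splitr e) ltrD//.
    exact: lt_trans (Hqi j) ke.
  rewrite distrC; apply: lt_trans ke.
  by move: (bz j); rewrite /c /= mxE in_itv/= ltr_distl.
by move=> i; rewrite /c /= mxE in_itv/= -ltr_distl.
Qed.

Lemma continuous_measurable_rV (f : rV -> R) : continuous f ->
  measurable_fun setT f.
Proof.
move=> cf; apply: (measurability _ (RGenOpens.measurableE R)).
move=> _ [_ [a [b ->] <-]]; rewrite setTI; apply: open_measurable_rV.
by apply: open_comp => // x _; exact: cf.
Qed.

End borel_rV.

Section lebesgue_rV_theory.
Variable R : realType.
Local Notation leb n := (lebesgue_rV R n).

Definition cube n (M : R) : set 'rV[R]_n :=
  [set y | forall i, `[- M, M]%classic (y ord0 i)].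

Lemma measurable_cube n M : measurable (@cube n M).
Proof.
apply: (@measurable_box _ _ (fun=> `[- M, M]%classic)) => i.
exact: measurable_itv.
Qed.

Lemma compact_cube n M : compact (@cube n M).
Proof.
apply: (@rV_compact _ _ (fun=> `[- M, M]%classic)) => i.
exact: segment_compact.
Qed.

Lemma preimage_cube n M :
  (fun p : measurableTypeR R * 'rV[R]_n => consr p.1 p.2) @^-1` (@cube n.+1 M) =
  `[- M, M]%classic `*` @cube n M.
Proof.
apply/seteqP; split => -[y0 y] /= => [h|[h0 h] i].
  split; first by have := h ord0; rewrite consr0.
  by move=> i; have := h (lift ord0 i); rewrite consrS.
by case: (unliftP ord0 i) => [j|] ->; rewrite ?consrS ?consr0//; exact: h.
Qed.

Lemma lebesgue_cube_lty n M : (leb n (@cube n M) < +oo)%E.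
Proof.
elim: n => [|n IH] /=.
  by rewrite /dirac indicE; case: (_ \in _); rewrite ltry.
rewrite /lebesgue_consr /pushforward preimage_cube product_measure1E//.
rewrite lte_mul_pinfty//= lebesgue_measure_itv/=; case: ifP => // _.
exact: measurable_cube.
Qed.

(** Bounded support is recorded by an explicit cube: its slices are cubes of the
    same size, which suits inductions on [n]. *)
Definition supp_in n M (f : 'rV[R]_n -> R) := forall x, ~ cube M x -> f x = 0.

Lemma cube_bounded n M (f : 'rV[R]_n -> R) : continuous f ->
  exists2 C, 0 <= C & forall x, cube M x -> `|f x| <= C.
Proof.
move=> cf; have [C [Creal HC]] := compact_bounded (continuous_compact
  (continuous_subspaceT cf) (@compact_cube n M)).
exists (Num.max 0 C + 1); first by rewrite addr_ge0// le_max lexx.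
move=> x Mx; apply: HC; last by exists x.
by rewrite ltr_pwDr// le_max lexx orbT.
Qed.

Lemma integrable_supp n M (f : 'rV[R]_n -> R) : continuous f -> supp_in M f ->
  (leb n).-integrable setT (EFin \o f).
Proof.
move=> cf fM; have [C C0 HC] := @cube_bounded n M f cf.
apply: (@le_integrable _ _ _ _ _ _ _
  (fun x => (C * \1_(@cube n M) x)%:E)) => //.
- by apply/measurable_EFinP; exact: continuous_measurable_rV.
- move=> x _ /=; rewrite lee_fin indicE.
  have [Mx|nMx] := pselect (cube M x).
    by rewrite mem_set// mulr1 (ger0_norm C0) HC.
  by rewrite memNset// mulr0 fM// normr0.
- under eq_fun do rewrite EFinM.
  apply: integrableZl => //; apply/integrableP; split.
    by apply/measurable_EFinP; apply: measurable_indic; exact: measurable_cube.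
  under eq_integral do rewrite gee0_abs ?lee_fin//.
  rewrite integral_indic ?setIT; [exact: lebesgue_cube_lty|by []|].
  exact: measurable_cube.
Qed.

Section fubini.
Variables (n : nat) (f : 'rV[R]_n.+1 -> R).
Hypothesis intf : (leb n.+1).-integrable setT (EFin \o f).
Local Open Scope ereal_scope.

Let fc (p : measurableTypeR R * 'rV[R]_n) : \bar R := (f (consr p.1 p.2))%:E.

Let mf : measurable_fun setT (EFin \o f).
Proof. exact: measurable_int intf. Qed.

Let intfc : (lebesgue_measure \x leb n).-integrable setT fc.
Proof.
apply/integrableP; split.
  exact: (measurableT_comp mf (@measurable_consr R n)).
have /integrableP[_] := intf.
rewrite [X in X < _ -> _](_ : _ =
  \int[lebesgue_consr (leb n)]_x `|(EFin \o f) x|)//.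
rewrite /lebesgue_consr ge0_integral_pushforward//.
  exact: measurable_consr.
exact: (measurableT_comp (@abse_measurable R setT) mf).
Qed.

Let integral_consr : \int[leb n.+1]_x (f x)%:E =
  \int[lebesgue_measure \x leb n]_p fc p.
Proof.
rewrite [LHS](_ : _ = \int[lebesgue_consr (leb n)]_x (EFin \o f) x)//.
rewrite /lebesgue_consr integral_pushforward//=.
exact: measurable_consr.
Qed.

Lemma integral_rV_fubini : \int[leb n.+1]_x (f x)%:E =
  \int[lebesgue_measure]_y0 \int[leb n]_y (f (consr y0 y))%:E.
Proof. by rewrite integral_consr -integral12_prod_meas1. Qed.

Lemma integral_rV_fubiniC : \int[leb n.+1]_x (f x)%:E =
  \int[leb n]_y \int[lebesgue_measure]_y0 (f (consr y0 y))%:E.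
Proof. by rewrite integral_consr -integral21_prod_meas1. Qed.

End fubini.

End lebesgue_rV_theory.

(** * Integration by parts and weak derivatives *)

Lemma consr_shift (R : realType) n (s h : R) (i : 'I_n) (y : 'rV[R]_n) :
  consr s (h *: delta_mx ord0 i + y) =
  h *: delta_mx ord0 (lift ord0 i) + consr s y.
Proof. by rewrite consr_line addrCA -consr_axis. Qed.

Section integration_by_parts.
Variable R : realType.
Local Notation leb n := (lebesgue_rV R n).

Lemma supp_in_partial n M (f : 'rV[R]_n -> R) i : supp_in M f ->
  supp_in M (partial i f).
Proof.
move=> fM x nMx; rewrite -(derive_cst (0 : R) x (delta_mx ord0 i)).
apply: near_eq_derive.
have : nbhs x (~` cube M).
  apply: open_nbhs_nbhs; split=> //; apply: closed_openC.
  apply: compact_closed; [exact: norm_hausdorff|exact: compact_cube].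
by apply: (@filterS _ (nbhs x)) => z nz; exact: fM.
Qed.

Lemma integral_derive_supp (g g' : R -> R) (M : R) : continuous g' ->
  (forall x : R, is_derive x 1 g (g' x)) ->
  (forall x, M < `|x| -> g x = 0) -> (forall x, M < `|x| -> g' x = 0) ->
  (\int[lebesgue_measure]_x (g' x)%:E = 0)%E.
Proof.
move=> cg' dg gM g'M; pose K := `|M| + 1.
have MK : M < K by rewrite (le_lt_trans (ler_norm _))// ltrDl.
have K0 : 0 < K by rewrite ltr_wpDl.
have cg : continuous g.
  move=> x; apply/differentiable_continuous/derivable1_diffP.
  exact: (@ex_derive _ _ _ _ _ _ _ (dg x)).
have gK : g K = 0 by apply: gM; rewrite gtr0_norm.
have gNK : g (- K) = 0 by apply: gM; rewrite normrN gtr0_norm.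
have NKK : - K < K by rewrite (lt_trans _ K0)// oppr_lt0.
have := @continuous_FTC2 R g' g (- K) K NKK (continuous_subspaceT cg').
rewrite gK gNK subee// => H; rewrite -[RHS]H; last first.
- by move=> x _; rewrite derive1E; apply: derive_val.
- split=> [x _||]; first exact: (@ex_derive _ _ _ _ _ _ _ (dg x)).
  + exact: cvg_at_right_filter (cg _).
  + exact: cvg_at_left_filter (cg _).
rewrite [RHS]integral_mkcond; apply: eq_integral => x _; rewrite patchE.
case: ifPn => // /negP h; congr EFin; apply: g'M; apply: (lt_le_trans MK).
rewrite leNgt; apply/negP => xK; apply: h; rewrite inE /= in_itv /=.
by rewrite -ler_norml ltW.
Qed.

(** Integrating first along coordinate [i] gives 0. As Lebesgue measure on
    [R^n] is built one coordinate at a time, this is an induction on [n], where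
    Fubini's theorem is used in one order for the first coordinate and in the
    other order for the remaining ones. *)
Lemma integral_partial_supp n (i : 'I_n) M (f : 'rV[R]_n -> R) :
  continuous f -> continuous (partial i f) ->
  (forall x, derivable f x (delta_mx ord0 i)) -> supp_in M f ->
  (\int[leb n]_x (partial i f x)%:E = 0)%E.
Proof.
elim: n i f => [[]//|n IH] i f cf cdf df fM.
have dfM := supp_in_partial i fM.
have intdf := integrable_supp cdf dfM.
case: (unliftP ord0 i) cdf df dfM intdf => [j|] -> cdf df dfM intdf.
  rewrite integral_rV_fubini//; apply: integral0_eq => y0 _.
  have E y : is_derive y (delta_mx ord0 j) (fun y => f (consr y0 y))
      (partial (lift ord0 j) f (consr y0 y)).
    apply/is_deriveP; under eq_fun do rewrite consr_shift.
    by apply/(is_deriveP f); exact: derivableP.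
  have pE : partial j (fun y => f (consr y0 y)) =
      (fun y => partial (lift ord0 j) f (consr y0 y)).
    by apply/funext => y; apply: derive_val.
  have cc (g : 'rV[R]_n.+1 -> R) : continuous g ->
      continuous (fun y => g (consr y0 y)).
    move=> cg y; apply: continuous_comp; last exact: cg.
    by apply: continuous_consr; [exact: cst_continuous|move=> A].
  under eq_integral do rewrite -[partial _ _ _](congr1 (@^~ _) pE).
  apply: (IH j (fun y => f (consr y0 y))).
  - exact: cc.
  - by rewrite pE; exact: cc.
  - by move=> y; exact: (@ex_derive _ _ _ _ _ _ _ (E y)).
  - move=> y nMy; apply: fM => h; apply: nMy => k.
    by have := h (lift ord0 k); rewrite consrS.
rewrite integral_rV_fubiniC//; apply: integral0_eq => y _.
have out y0 : M < `|y0| -> ~ cube M (consr y0 y).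
  move=> My0 /(_ ord0); rewrite consr0 /= in_itv/= -ler_norml.
  by rewrite leNgt My0.
apply: (@integral_derive_supp (fun y0 => f (consr y0 y)) _ M).
- move=> y0; apply: continuous_comp; last exact: cdf.
  by apply: continuous_consr; [move=> A|exact: cst_continuous].
- move=> y0; under eq_fun do rewrite consr_axis; rewrite (consr_axis y0).
  by apply/is_derive_line; exact: (derivableP (df _)).
- by move=> y0 My0; apply: fM; exact: out.
- by move=> y0 My0; apply: dfM; exact: out.
Qed.

End integration_by_parts.

Section weak_derivatives.
Variables (R : realType) (n : nat).
Local Notation leb := (lebesgue_rV R n).
Implicit Types f g v w : 'rV[R]_n -> R.

Lemma bounded_cube (A : set 'rV[R]_n) : compact A ->
  exists M, A `<=` cube M.
Proof.
move=> /compact_bounded[C [Creal HC]]; exists (`|C| + 1) => x Ax i /=.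
have := HC (`|C| + 1) _ x Ax; rewrite in_itv/= -ler_norml => H.
have xi : `|x ord0 i| <= `|x|.
  rewrite [leRHS]/Num.norm /= mx_normrE; apply/bigmax_geP; right.
  by exists (ord0, i).
by apply: le_trans xi _; apply: H; rewrite (le_lt_trans (ler_norm _))// ltrDl.
Qed.

Lemma test_function_supp v : test_function v -> exists M, supp_in M v.
Proof.
move=> [_ /bounded_cube[M HM]]; exists M => x nMx.
apply: contrapT => /eqP vx; apply: nMx; apply: HM; exact: subset_closure.
Qed.

Lemma compact_measurable_rV (K : set 'rV[R]_n) : compact K -> measurable K.
Proof.
move=> cK; rewrite -(setCK K); apply: measurableC; apply: open_measurable_rV.
by apply: closed_openC; apply: compact_closed => //; exact: norm_hausdorff.
Qed.

Lemma continuous_locally_integrable f : continuous f -> rV_locally_integrable f.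
Proof.
move=> cf; split; first exact: continuous_measurable_rV.
move=> K cK; have mK := compact_measurable_rV cK.
have [M KM] := bounded_cube cK; have [C C0 HC] := cube_bounded M cf.
apply: (@le_lt_trans _ _ (\int[leb]_(x in K) (cst C%:E) x)%E).
  apply: ge0_le_integral => //.
  - apply/measurable_EFinP; apply: measurable_funTS.
    by apply: continuous_measurable_rV => x; exact: (cvg_norm (cf x)).
  - by move=> x Kx; rewrite lee_fin HC//; exact: KM.
rewrite integral_cst// lte_mul_pinfty//.
apply: (@le_lt_trans _ _ (leb (cube M))); last exact: lebesgue_cube_lty.
by apply: le_measure => //; rewrite inE//; exact: measurable_cube.
Qed.

Lemma integral_by_parts i M f v : continuous f -> continuous v ->
  continuous (partial i f) -> continuous (partial i v) ->
  (forall x, derivable f x (delta_mx ord0 i)) ->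
  (forall x, derivable v x (delta_mx ord0 i)) -> supp_in M v ->
  (\int[leb]_x (f x * partial i v x)%:E =
   (-1)%:E * \int[leb]_x (partial i f x * v x)%:E)%E.
Proof.
move=> cf cv cdf cdv df dv vM; have dvM := supp_in_partial i vM.
have c1 : continuous (fun x => f x * partial i v x).
  by move=> x; exact: (cvgM (cf x) (cdv x)).
have c2 : continuous (fun x => partial i f x * v x).
  by move=> x; exact: (cvgM (cdf x) (cv x)).
have I1 : leb.-integrable setT (fun x => (f x * partial i v x)%:E).
  apply: (integrable_supp c1 (M := M)) => x nx; by rewrite dvM// mulr0.
have I2 : leb.-integrable setT (fun x => (partial i f x * v x)%:E).
  apply: (integrable_supp c2 (M := M)) => x nx; by rewrite vM// mulr0.
have dE x : is_derive x (delta_mx ord0 i) (fun x => f x * v x)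
    (partial i f x * v x + f x * partial i v x).
  exact: is_derive_mul (derivableP (df x)) (derivableP (dv x)).
have pE : partial i (fun x => f x * v x) =
    (fun x => partial i f x * v x + f x * partial i v x).
  by apply/funext => x; apply: derive_val.
have : (\int[leb]_x (partial i (fun x => f x * v x) x)%:E = 0)%E.
  apply: (integral_partial_supp (M := M)).
  - by move=> x; exact: (cvgM (cf x) (cv x)).
  - by rewrite pE => x; exact: (cvgD (c2 x) (c1 x)).
  - by move=> x; exact: (@ex_derive _ _ _ _ _ _ _ (dE x)).
  - by move=> x nx; rewrite vM// mulr0.
rewrite pE; under eq_integral do rewrite EFinD.
rewrite integralD//= => E.
have F1 := integrable_fin_num measurableT I1.
have F2 := integrable_fin_num measurableT I2.
rewrite -(fineK F1) -(fineK F2) -EFinM; congr EFin.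
move: E; rewrite -(fineK F1) -(fineK F2) -EFinD => -[/eqP].
by rewrite addrC addr_eq0 => /eqP ->; rewrite mulN1r.
Qed.

Lemma test_partials v s : test_function v ->
  continuous (partials s v) /\
  forall i x, derivable (partials s v) x (delta_mx ord0 i).
Proof.
move=> [vC _].
have hs i : (count_mem i s <= [ffun i => (count_mem i s).+1] i)%N.
  by rewrite ffunE.
have [c d] := vC [ffun i => (count_mem i s).+1] s hs.
by split=> // i x; apply: d; rewrite ffunE.
Qed.

Lemma supp_in_partials M v s : supp_in M v -> supp_in M (partials s v).
Proof. by move=> vM; elim: s => // i s IH; exact: supp_in_partial. Qed.

(** Each integration by parts moves the outermost derivative of [v] to [g], so
    the derivatives arrive on [g] in reverse order. *)
Lemma integral_by_parts_seq nu g v s acc : Cmi nu g -> test_function v ->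
  (forall i, count_mem i (catrev s acc) <= nu i)%N ->
  (\int[leb]_x (partials acc g x * partials s v x)%:E =
   ((-1) ^+ size s)%:E * \int[leb]_x (partials (catrev s acc) g x * v x)%:E)%E.
Proof.
move=> gnu tv; have [M vM] := test_function_supp tv.
elim: s acc => [|i s IH] acc hs; first by rewrite expr0 mul1e.
have ok_iacc j : (count_mem j (i :: acc) <= nu j)%N.
  apply: leq_trans (hs j).
  by rewrite /= catrevE count_cat count_rev /= leq_addl.
have ok_acc j : (count_mem j acc <= nu j)%N.
  by apply: leq_trans (ok_iacc j); rewrite /= leq_addl.
have [cv dv] := test_partials s tv.
have [cv' _] := test_partials (i :: s) tv.
have [ca da] := gnu _ ok_acc.
have [ca' _] := gnu _ ok_iacc.
have ilt : (count_mem i acc < nu i)%N.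
  by have := ok_iacc i; rewrite /= eqxx.
rewrite partials_cons (integral_by_parts ca cv ca' cv' (da i ilt) (dv i)
  (supp_in_partials s vM)).
rewrite -[partial i (partials acc g)]/(partials (i :: acc) g).
by rewrite IH//= muleA -EFinM exprS.
Qed.

(** The sequence [s] is the canonical one reversed, because each integration by
    parts moves the outermost derivative of the test function. *)
Lemma weak_derivative_partials nu eta g : Cmi nu g -> mle eta nu ->
  exists2 s, mcount s = eta & is_weak_derivative eta g (partials s g).
Proof.
move=> gnu le_eta.
set s := flatten [seq nseq (eta j) j | j <- enum 'I_n].
have sE : mcount s = eta.
  by apply/ffunP => i; rewrite ffunE count_mderive_seq.
have rsE : mcount (rev s) = eta.
  by rewrite -sE; apply/ffunP => i; rewrite !ffunE count_rev.
have hs i : (count_mem i (rev s) <= nu i)%N.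
  by have /mleP/(_ i) := le_eta; rewrite -rsE ffunE.
exists (rev s) => //; split.
  by apply: continuous_locally_integrable; apply: (gnu _ hs).1.
move=> v tv; have -> : mnorm eta = size s by rewrite -sE mnorm_mcount.
exact: (integral_by_parts_seq (acc := [::]) gnu tv hs).
Qed.

End weak_derivatives.

(** * Smooth bump functions *)

Section bumps.
Variable R : realType.
Implicit Types (f g : R -> R) (p : {poly R}).

(** Recursion on the derivative, rather than a condition on each iterated
    derivative, makes closure under products a plain induction. *)
Fixpoint smooth_upto (n : nat) f : Prop :=
  if n is m.+1 then (forall x : R, derivable f x 1) /\ smooth_upto m (derive1 f)
  else True.

Definition smooth f := forall n, smooth_upto n f.

Lemma smooth_uptoW n f : smooth_upto n.+1 f -> smooth_upto n f.
Proof. by elim: n f => // n IH f [df /IH]. Qed.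

Lemma smooth_uptoD n f g : smooth_upto n f -> smooth_upto n g ->
  smooth_upto n (fun x => f x + g x).
Proof.
elim: n f g => // n IH f g [df sf] [dg sg]; split=> [x|].
  exact: derivableD.
rewrite (_ : derive1 _ = fun x => derive1 f x + derive1 g x); first exact: IH.
by apply/funext => x; rewrite !derive1E deriveD.
Qed.

Lemma smooth_uptoM n f g : smooth_upto n f -> smooth_upto n g ->
  smooth_upto n (fun x => f x * g x).
Proof.
elim: n f g => // n IH f g sf sg; split=> [x|].
  by apply: derivableM; [exact: sf.1|exact: sg.1].
rewrite (_ : derive1 _ = fun x => derive1 f x * g x + f x * derive1 g x).
  by apply: smooth_uptoD; apply: IH; [exact: sf.2|exact: smooth_uptoW|
    exact: smooth_uptoW|exact: sg.2].
apply/funext => x; rewrite !derive1E.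
have := is_derive_mul (derivableP (sf.1 x)) (derivableP (sg.1 x)).
by move=> /@derive_val.
Qed.

Lemma is_derive_affine f (a b x D : R) : is_derive (a * x + b) 1 f D ->
  is_derive x 1 (fun x => f (a * x + b)) (a * D).
Proof.
move=> H; have A : is_derive x 1 (fun x => a * x + b) a.
  have := is_deriveD (is_derive_mul (is_derive_cst a x (1 : R))
    (is_derive_id x (1 : R))) (is_derive_cst b x (1 : R)).
  by rewrite mul0r add0r mulr1 addr0.
by rewrite mulrC; exact: (@is_derive1_comp _ f (fun x => a * x + b) x _ _ H A).
Qed.

Lemma smooth_upto_cst n (a : R) : smooth_upto n (cst a).
Proof.
elim: n a => // n IH a; split=> [x|]; first exact: derivable_cst.
rewrite (_ : derive1 (cst a) = cst 0)//.
by apply/funext => x; rewrite derive1_cst.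
Qed.

Lemma smooth_upto_affine n f (a b : R) : smooth_upto n f ->
  smooth_upto n (fun x => f (a * x + b)).
Proof.
elim: n f => // n IH f [df sf]; split=> [x|].
  exact: (@ex_derive _ _ _ _ _ _ _ (is_derive_affine (derivableP (df _)))).
rewrite (_ : derive1 _ = fun x => cst a x * derive1 f (a * x + b)).
  by apply: smooth_uptoM; [exact: smooth_upto_cst|exact: IH].
apply/funext => x; rewrite !derive1E /=.
exact: (@derive_val _ _ _ _ _ _ _ (is_derive_affine (derivableP (df _)))).
Qed.

(** The derivatives of [x |-> exp (- 1 / x)] (continued by 0) all have this
    form, [p] being a polynomial in [1 / x]. *)
Definition flat p (x : R) : R := if 0 < x then p.[x^-1] * expR (- x^-1) else 0.

(** Each monomial satisfies [u ^ i <= i! * exp u], by the exponential series. *)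
Lemma poly_expR_bound p : exists2 C, 0 <= C &
  forall u : R, 0 <= u -> `|p.[u]| * expR (- u) <= C.
Proof.
exists (\sum_(i < size p) `|p`_i| * i`!%:R); first by apply: sumr_ge0 => i _.
move=> u u0; rewrite expRN ler_pdivrMr ?expR_gt0// mulr_suml horner_coef.
apply: le_trans (ler_norm_sum _ _ _) _; apply: ler_sum => i _.
rewrite normrM -mulrA ler_wpM2l// normrX (ger0_norm u0).
case: (nat_of_ord i) => [|k].
  by rewrite expr0 mul1r; apply: le_trans (expR_ge1Dx u); rewrite lerDl.
have k0 : 0 < k.+1`!%:R :> R by rewrite ltr0n fact_gt0.
rewrite mulrC -ler_pdivrMr//; apply: le_trans (expR_ge1Dxn k u0).
by rewrite lerDr.
Qed.

Lemma flat_le0 p x : x <= 0 -> flat p x = 0.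
Proof. by rewrite /flat ltNge => ->. Qed.

Lemma is_derive_flat p (x : R) :
  is_derive x 1 (flat p) (flat ('X^2 * (p - p^`())) x).
Proof.
have [x0|x0|->] := ltgtP x 0.
- rewrite flat_le0 ?ltW//.
  have H : \forall y \near x, cst (0 : R) y = flat p y.
    near=> y; rewrite flat_le0//; apply: ltW; near: y.
    exact: (cvgr_lt x cvg_id).
  exact: (near_eq_is_derive H (is_derive_cst (0 : R) x (1 : R))).
- have xn0 := lt0r_neq0 x0.
  have H : \forall y \near x, p.[y^-1] * expR (- y^-1) = flat p y.
    near=> y; rewrite /flat ifT//; near: y.
    exact: (cvgr_gt x cvg_id).
  apply: (near_eq_is_derive H).
  have dV : is_derive x 1 (fun y : R => y^-1) (- (x^-1 ^+ 2)).
    have := is_derive_inv xn0 (is_derive_id x (1 : R)).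
    by rewrite div1r mulNr expr2.
  have d1 := is_derive_comp1 (is_derive_poly p x^-1) dV.
  have d2 := is_derive_comp1 (f := fun y : R => - y^-1)
    (is_derive_expR (- x^-1)) (is_derive_opp dV).
  apply: is_derive_eq (is_derive_mul d1 d2) _.
  rewrite /flat x0 !hornerE /=.
  ring.
- rewrite flat_le0//; apply/is_deriveP.
  have [C C0 HC] := poly_expR_bound ('X^2 * p).
  (* The quotient at 0 is [u^2 p(u) exp(-u) h] with [u = 1 / h]. *)
  have B h : `|h^-1 * (flat p (h *: (1 : R) + 0) - flat p 0)| <= C * `|h|.
    rewrite addr0 [_ *: _]mulr1 [flat p 0]flat_le0// subr0.
    have [h0|h0] := leP h 0; first by rewrite flat_le0// mulr0 normr0 mulr_ge0.
    have := HC h^-1; rewrite invr_ge0 ltW// => /(_ isT).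
    rewrite /flat h0 !hornerE normrM normrX !normrM.
    rewrite (ger0_norm (expR_ge0 _)) (gtr0_norm h0) normfV (gtr0_norm h0).
    move=> HC'.
    rewrite -ler_pdivrMr//; apply: le_trans HC'.
    move: (`|p.[_]|) (expR _) => P E; rewrite le_eqVlt; apply/orP; left.
    by apply/eqP; ring.
  apply/(@cvgrPdist_le _ _ _ (dnbhs (0 : R))) => e e0.
  have C1 : 0 < C + 1 by rewrite ltr_wpDl.
  apply: nbhs_dnbhs; apply/nbhs_ballP; exists (e / (C + 1)) => /=.
    by rewrite divr_gt0.
  move=> h; rewrite -ball_normE /= !sub0r !normrN => hd.
  apply: le_trans (B h) _; rewrite (le_trans (ler_wpM2l C0 (ltW hd)))//.
  by rewrite mulrCA ger_pMr// ler_pdivrMr// mul1r lerDl.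
Unshelve. all: by end_near. Qed.

Lemma smooth_flat p : smooth (flat p).
Proof.
move=> n; elim: n p => // n IH p; split=> [x|].
  exact: (@ex_derive _ _ _ _ _ _ _ (is_derive_flat p x)).
rewrite (_ : derive1 _ = flat ('X^2 * (p - p^`()))); first exact: IH.
apply/funext => x; rewrite derive1E.
exact: (@derive_val _ _ _ _ _ _ _ (is_derive_flat p x)).
Qed.

(** The factors [exp (- 1 / (k (x - a)))] and [exp (- 1 / (k (b - x)))] tend to
    1 as the steepness [k] grows, so that the bumps approximate the indicator of
    ]a, b[ and stay below it. *)
Definition bumpf (a b k x : R) : R :=
  flat 1 (k * x + - (k * a)) * flat 1 (- k * x + k * b).

Lemma smooth_bump a b k : smooth (bumpf a b k).
Proof.
by move=> n; apply: smooth_uptoM; apply: smooth_upto_affine; exact: smooth_flat.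
Qed.

Lemma flat1_itv x : 0 <= flat 1 x <= 1.
Proof.
rewrite /flat; case: ltP => x0; last by rewrite lexx ler01.
by rewrite hornerE mul1r expR_ge0 /= -expR0 ler_expR oppr_le0 invr_ge0 ltW.
Qed.

Lemma bump_bound a b k x : 0 <= bumpf a b k x <= 1.
Proof.
have /andP[h1 h2] := flat1_itv (k * x + - (k * a)).
have /andP[h3 h4] := flat1_itv (- k * x + k * b).
by rewrite /bumpf mulr_ge0//= mulr_ile1.
Qed.

Lemma bump_out a b k x : 0 <= k -> x \notin `]a, b[ -> bumpf a b k x = 0.
Proof.
move=> k0; rewrite in_itv/= negb_and -!leNgt /bumpf => /orP[xa|bx].
  by rewrite flat_le0 ?mul0r// -mulrBr mulr_ge0_le0// subr_le0.
by rewrite [flat _ _ in X in _ * X]flat_le0 ?mulr0// addrC mulNr -mulrBr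
  mulr_ge0_le0// subr_le0.
Qed.

Lemma cvg_flat1 c : 0 < c -> flat 1 (k.+1%:R * c) @[k --> \oo] --> (1 : R).
Proof.
move=> c0; rewrite -[X in _ --> X]expR0 -oppr0.
have -> : (fun k => flat 1 (k.+1%:R * c)) =
    (fun k => expR (- (harmonic k * c^-1))).
  apply/funext => k; rewrite /flat mulr_gt0 ?ltr0n// hornerE mul1r.
  by rewrite invfM.
apply: continuous_cvg; first exact: continuous_expR.
have := cvgN (cvgM (@cvg_harmonic R) (@cvg_cst R c^-1 _ (nbhs \oo) _)).
rewrite mul0r; exact.
Qed.

Lemma cvg_bump a b x :
  bumpf a b k.+1%:R x @[k --> \oo] --> (\1_(`]a, b[%classic) x : R).
Proof.
rewrite indicE; have [xab|xab] := boolP (x \in `]a, b[).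
  rewrite mem_set//= -[X in _ --> X]mulr1 /bumpf.
  move: xab; rewrite in_itv/= => /andP[ax xb].
  apply: cvgM.
    under eq_fun do rewrite -mulrBr.
    by apply: cvg_flat1; rewrite subr_gt0.
  under eq_fun do rewrite addrC mulNr -mulrBr.
  by apply: cvg_flat1; rewrite subr_gt0.
rewrite memNset/=; last exact/negP.
rewrite [X in X @ _ --> _](_ : _ = cst 0); first exact: cvg_cst.
by apply/funext => k; rewrite bump_out.
Qed.


End bumps.

Section product_test_functions.
Variables (R : realType) (n : nat).
Implicit Types (h : 'I_n -> R -> R).

Definition prod_fun h (y : 'rV[R]_n) : R := \prod_i h i (y ord0 i).

Lemma smooth_derivable (f : R -> R) (x : R) : smooth f -> derivable f x 1.
Proof. by move=> /(_ 1%N)[]. Qed.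

Lemma smooth_derive1 (f : R -> R) : smooth f -> smooth (derive1 f).
Proof. by move=> sf m; exact: (sf m.+1).2. Qed.

Lemma smooth_continuous (f : R -> R) : smooth f -> continuous f.
Proof.
move=> sf x; apply/differentiable_continuous/derivable1_diffP.
exact: smooth_derivable.
Qed.

Lemma continuous_prod_fun h : (forall i, continuous (h i)) ->
  continuous (prod_fun h).
Proof.
move=> ch; rewrite /prod_fun; elim: (index_enum _) => [|i s IH].
  under eq_fun do rewrite big_nil; exact: cst_continuous.
under eq_fun do rewrite big_cons; move=> y.
have ci : {for y, continuous (fun z : 'rV[R]_n => h i (z ord0 i))}.
  by apply: continuous_comp; [exact: coord_continuous|exact: ch].
exact: (cvgM ci (IH y)).
Qed.

Definition derive_factor i h : 'I_n -> R -> R :=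
  fun j => if j == i then derive1 (h j) else h j.

Lemma is_derive_prod_fun h i (y : 'rV[R]_n) : (forall j, smooth (h j)) ->
  is_derive y (delta_mx ord0 i) (prod_fun h) (prod_fun (derive_factor i h) y).
Proof.
move=> sh; have E z : prod_fun h z =
    h i (z ord0 i) * \prod_(j | j != i) h j (z ord0 j).
  by rewrite /prod_fun (bigD1 i).
have E' : prod_fun (derive_factor i h) y =
    derive1 (h i) (y ord0 i) * \prod_(j | j != i) h j (y ord0 j).
  rewrite /prod_fun (bigD1 i)//= /derive_factor eqxx; congr (_ * _).
  by apply: eq_bigr => j /negPf ->.
rewrite E'; apply/is_deriveP.
have -> : (fun k : R => k^-1 * (prod_fun h (k *: delta_mx ord0 i + y) -
      prod_fun h y)) =
    (fun k : R => k^-1 * (h i (k *: (1 : R) + y ord0 i) - h i (y ord0 i)) *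
      \prod_(j | j != i) h j (y ord0 j)).
  apply/funext => k; rewrite !E -mulrA mulrBl !mxE !eqxx /=.
  congr (_ * (h i (_ * _ + _) * _ - _)).
  apply: eq_bigr => j ji; rewrite !mxE eqxx /= (negPf ji).
  by rewrite mulr0 add0r.
have := (is_deriveP (h i) (y ord0 i) 1 _).2
  (derivableP (@smooth_derivable (h i) (y ord0 i) (sh i))).
rewrite -derive1E => H; exact: (cvgM H (cvg_cst _)).
Qed.

Lemma smooth_derive_factor i h : (forall j, smooth (h j)) ->
  forall j, smooth (derive_factor i h j).
Proof.
move=> sh j; rewrite /derive_factor; case: eqP => // _.
exact: smooth_derive1.
Qed.

Lemma partials_prod_fun s h : (forall j, smooth (h j)) ->
  exists2 h', (forall j, smooth (h' j)) & partials s (prod_fun h) = prod_fun h'.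
Proof.
elim: s => [|i s IH] sh; first by exists h.
have [h' sh' E] := IH sh.
exists (derive_factor i h'); first exact: smooth_derive_factor.
rewrite partials_cons E; apply/funext => y.
exact: (@derive_val _ _ _ _ _ _ _ (is_derive_prod_fun i y sh')).
Qed.

Lemma prod_fun_test h M : (forall j, smooth (h j)) -> supp_in M (prod_fun h) ->
  test_function (prod_fun h).
Proof.
move=> sh hM; split.
  move=> nu s _; have [h' sh' ->] := partials_prod_fun s sh; split.
    by apply: continuous_prod_fun => i; exact: smooth_continuous.
  move=> i _ x.
  exact: (@ex_derive _ _ _ _ _ _ _ (is_derive_prod_fun i x sh')).
have cM : closed (@cube R n M).
  by apply: compact_closed; [exact: norm_hausdorff|exact: compact_cube].
apply: (subclosed_compact _ (@compact_cube R n M)); first exact: closed_closure.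
rewrite closureE; apply: smallest_sub => // x /= /eqP hx.
by apply: contrapT => nMx; apply: hx; exact: hM.
Qed.

Definition box_bump (a b : 'I_n -> R) (k : nat) :=
  prod_fun (fun i => bumpf (a i) (b i) k.+1%:R).

Definition box (a b : 'I_n -> R) : set 'rV[R]_n :=
  [set y | forall i, `]a i, b i[%classic (y ord0 i)].

Lemma box_bump_bound a b k y : 0 <= box_bump a b k y <= 1.
Proof.
apply/andP; split.
  apply: prodr_ge0 => i _.
  by have /andP[] := bump_bound (a i) (b i) k.+1%:R (y ord0 i).
by apply: prodr_ile1 => i _; exact: bump_bound.
Qed.

Lemma box_bump_out a b k y : ~ box a b y -> box_bump a b k y = 0.
Proof.
move=> /existsNP[i hi].
rewrite /box_bump /prod_fun (bigD1 i)//= bump_out ?mul0r//.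
by apply/negP.
Qed.

Lemma cvg_box_bump a b y :
  box_bump a b k y @[k --> \oo] --> (\1_(box a b) y : R).
Proof.
have -> : \1_(box a b) y = \prod_i (\1_(`]a i, b i[%classic) (y ord0 i)) :> R.
  have [yb|yb] := pselect (box a b y).
    by rewrite indicE mem_set// big1// => i _; rewrite indicE mem_set.
  rewrite indicE memNset//; have /existsNP[i hi] := yb.
  by rewrite (bigD1 i)//= indicE memNset// mul0r.
rewrite /box_bump /prod_fun; elim: (index_enum _) => [|i s IH].
  by under eq_fun do rewrite big_nil; rewrite big_nil; exact: cvg_cst.
under eq_fun do rewrite big_cons; rewrite big_cons.
by apply: cvgM; [exact: cvg_bump|exact: IH].
Qed.

Lemma box_cube a b : exists M, box a b `<=` cube M.
Proof.
exists (\sum_i (`|a i| + `|b i|)) => y yb i /=.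
have := yb i; rewrite /= !in_itv/= => /andP[ay yb'].
rewrite -ler_norml (bigD1 i)//=.
apply: (@le_trans _ _ (`|a i| + `|b i|)); last first.
  by rewrite lerDl sumr_ge0// => j _; rewrite addr_ge0.
rewrite ler_norml (le_trans _ (ltW ay)) ?(le_trans (ltW yb'))//.
  by rewrite (le_trans (ler_norm _))// lerDr.
by rewrite lerNl (le_trans (ler_norm _))// normrN lerDl.
Qed.

Lemma box_bump_test a b k : test_function (box_bump a b k).
Proof.
have [M HM] := box_cube a b.
apply: (@prod_fun_test _ M) => [i|y nMy]; first exact: smooth_bump.
by apply: box_bump_out => /HM.
Qed.

End product_test_functions.

(** * Uniqueness of weak derivatives *)

Section du_bois_reymond.
Variables (R : realType) (n : nat).
Local Notation leb := (lebesgue_rV R n).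
Local Notation box := (@box R n).
Implicit Types u w v : 'rV[R]_n -> R.

Lemma measurable_boxes (a b : 'I_n -> R) : measurable (box a b).
Proof.
apply: (@measurable_box _ _ (fun i => `]a i, b i[%classic)) => i.
exact: measurable_itv.
Qed.

Lemma integrable_cube u M : rV_locally_integrable u ->
  leb.-integrable (cube M) (EFin \o u).
Proof.
move=> [mu hu]; apply/integrableP; split.
  by apply/measurable_EFinP; exact: measurable_funTS.
by have := hu _ (@compact_cube R n M).
Qed.

Lemma integrable_abs_cube u M : rV_locally_integrable u ->
  leb.-integrable setT (fun x => (`|u x| * \1_(cube M) x)%:E).
Proof.
move=> lu; have [mu _] := lu.
have /integrableP[_ H] := integrable_cube M lu.
apply/integrableP; split.
  apply/measurable_EFinP; apply: measurable_funM.
    exact: measurableT_comp.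
  by apply: measurable_indic; exact: measurable_cube.
move: H; rewrite integral_mkcond; congr (_ < _)%E.
apply: eq_integral => x _; rewrite patchE indicE /=.
by case: ifP => _; rewrite ?mulr1 ?mulr0 ?normr_id ?normr0.
Qed.

(** Dominated convergence, with bumps as test functions: they increase to the
    indicator of the box. *)
Lemma integral_box_eq0 u a b : rV_locally_integrable u ->
  (forall v, test_function v -> (\int[leb]_x (u x * v x)%:E = 0)%E) ->
  (\int[leb]_(x in box a b) (u x)%:E = 0)%E.
Proof.
move=> lu hu; have [M bM] := box_cube a b; have [mu _] := lu.
have mf k : measurable_fun [set: 'rV[R]_n]
    (fun x => (u x * box_bump a b k x)%:E).
  apply/measurable_EFinP; apply: measurable_funM => //.
  apply: continuous_measurable_rV; apply: continuous_prod_fun => i.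
  exact/smooth_continuous/smooth_bump.
have mg : measurable_fun [set: 'rV[R]_n] (fun x => (u x * \1_(box a b) x)%:E).
  apply/measurable_EFinP; apply: measurable_funM => //.
  by apply: measurable_indic; exact: measurable_boxes.
have ic := integrable_abs_cube M lu.
have lim : {ae leb, forall x, [set: 'rV[R]_n] x ->
    (fun k => (u x * box_bump a b k x)%:E) @ \oo -->
    (u x * \1_(box a b) x)%:E}.
  apply: aeW => x _; apply: cvg_EFin; first exact: nearW.
  have := cvgM (@cvg_cst R (u x) _ (nbhs \oo) _) (@cvg_box_bump R n a b x).
  exact.
have dom : {ae leb, forall x k, [set: 'rV[R]_n] x ->
    (`|(u x * box_bump a b k x)%:E| <= (`|u x| * \1_(cube M) x)%:E)%E}.
  apply: aeW => x k _; rewrite lee_fin normrM ler_wpM2l//.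
  have /andP[h0 h1] := box_bump_bound a b k x.
  rewrite (ger0_norm h0) indicE; have [Mx|nMx] := pselect (cube M x).
    by rewrite mem_set.
  by rewrite box_bump_out// => /bM.
have [_ _ H] := dominated_convergence measurableT mf mg lim ic dom.
have Z : (fun k => \int[leb]_x (u x * box_bump a b k x)%:E)%E = (fun=> 0%E).
  by apply/funext => k; apply: hu; exact: box_bump_test.
have {}H : (\int[leb]_x (u x * \1_(box a b) x)%:E = 0)%E.
  rewrite Z in H; apply: (cvg_unique _ H); first exact: ereal_hausdorff.
  exact: cvg_cst.
rewrite integral_mkcond -[RHS]H; apply: eq_integral => x _.
rewrite patchE indicE; case: ifP => _; first by rewrite mulr1.
by rewrite mulr0.
Qed.

(** Some factors may be all of [R], so that this pi-system contains the
    coordinate slabs, which generate the sigma-algebra. *)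
Definition open_boxes : set (set 'rV[R]_n) :=
  [set P | exists2 c : 'I_n -> set R,
    forall i, c i = setT \/ exists x y, c i = `]x, y[%classic &
    P = [set y : 'rV[R]_n | forall i, c i (y ord0 i)]].

Lemma setI_closed_open_boxes : setI_closed open_boxes.
Proof.
move=> _ _ [c hc ->] [c' hc' ->]; exists (fun i => c i `&` c' i); last first.
  apply/seteqP; split=> y /=; first by move=> [h h'] i; split.
  by move=> h; split=> i; have [] := h i.
move=> i; have [->|[x [y ->]]] := hc i; have [->|[x' [y' ->]]] := hc' i.
- by left; rewrite setTI.
- by right; exists x', y'; rewrite setTI.
- by right; exists x, y; rewrite setIT.
right; exists (Num.max x x'), (Num.min y y').
apply/seteqP; split=> z /=; rewrite !in_itv/= gt_max lt_min.
  by move=> [/andP[-> ->] /andP[-> ->]].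
by move=> /andP[/andP[-> ->] /andP[-> ->]].
Qed.

Lemma sub_measurable_open_boxes : @measurable _ 'rV[R]_n `<=` <<s open_boxes >>.
Proof.
have mcoord (i : 'I_n) : measurable_fun
    (setT : set (g_sigma_algebraType open_boxes))
    (fun y : 'rV[R]_n => y ord0 i : R).
  apply: (measurability _ (RGenOpens.measurableE R)).
  move=> _ [_ [x [y ->] <-]]; rewrite setTI; apply: sub_sigma_algebra.
  exists (fun j => if j == i then `]x, y[%classic else setT).
    by move=> j; case: eqP => _; [right; exists x, y|left].
  apply/seteqP; split=> z /= h; first by move=> j; case: eqP => // ->.
  by have := h i; rewrite eqxx.
apply: smallest_sub; first exact: smallest_sigma_algebra.
rewrite -bigcup_seq => P [i _ [Y mY <-]].
exact: (mcoord i measurableT Y mY).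
Qed.

(** By Dynkin's theorem: the Borel sets with this property form a Dynkin system
    containing the pi-system [open_boxes]. Intersecting with a bounded box makes
    [u] integrable. *)
Lemma integral_setI_box_eq0 u M E : rV_locally_integrable u ->
  (forall v, test_function v -> (\int[leb]_x (u x * v x)%:E = 0)%E) ->
  measurable E ->
  (\int[leb]_(x in E `&` box (fun=> (- M)%R) (fun=> M)) (u x)%:E = 0)%E.
Proof.
move=> lu hu mE; set Q := box _ _.
have mQ : measurable Q by exact: measurable_boxes.
have iQ : leb.-integrable Q (EFin \o u).
  apply: integrableS (integrable_cube M lu) => //.
    exact: measurable_cube.
  move=> y Qy i; have := Qy i; rewrite /= !in_itv/= => /andP[h1 h2].
  by rewrite !ltW.
have mI A : measurable A -> measurable (A `&` Q).
  by move=> ?; exact: measurableI.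
have iA A : measurable A -> leb.-integrable (A `&` Q) (EFin \o u).
  by move=> mA; apply: integrableS iQ => //; exact: mI.
pose H := [set A : set 'rV[R]_n | measurable A /\
  (\int[leb]_(x in A `&` Q) (u x)%:E = 0)%E].
suff : H E by case.
have dH : dynkin H.
  split.
  - by split=> //; rewrite setTI; exact: integral_box_eq0.
  - move=> A [mA hA]; split; first exact: measurableC.
    have := integral_box_eq0 (fun=> - M) (fun=> M) lu hu.
    have -> : box (fun=> - M) (fun=> M) = (A `&` Q) `|` (~` A `&` Q).
      by rewrite -setIUl setUv setTI.
    rewrite integral_setU ?hA ?add0e//.
    + exact: mI.
    + by apply: mI; exact: measurableC.
    + rewrite -setIUl setUv setTI; exact: measurable_int iQ.
    + apply/disj_setPS => x [[Ax _] [nAx _]]; exact: nAx.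
  - move=> F tF HF; split.
      by apply: bigcup_measurable => k _; exact: (HF k).1.
    rewrite setI_bigcupl integral_bigcup.
    + by rewrite eseries0// => k _ _; exact: (HF k).2.
    + exact: trivIset_setIr.
    + by move=> k; apply: mI; exact: (HF k).1.
    + rewrite -setI_bigcupl; apply: iA.
      by apply: bigcup_measurable => k _; exact: (HF k).1.
have sub : <<d open_boxes >> `<=` H.
  apply: smallest_sub => // P [c hc ->]; split.
    apply: (@measurable_box _ _ c) => i.
    by have [->|[x [y ->]]] := hc i; [exact: measurableT|exact: measurable_itv].
  have /choice[q hq] : forall i, exists q : R * R,
      c i `&` `]- M, M[%classic = `]q.1, q.2[%classic.
    move=> i; have [->|[x [y ->]]] := hc i.
      by exists (- M, M); rewrite setTI.
    exists (Num.max x (- M), Num.min y M); apply/seteqP.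
    split=> z /=; rewrite !in_itv/= gt_max lt_min.
      by move=> [/andP[-> ->] /andP[-> ->]].
    by move=> /andP[/andP[-> ->] /andP[-> ->]].
  have -> : [set y : 'rV[R]_n | forall i, c i (y ord0 i)] `&` Q =
      box (fun i => (q i).1) (fun i => (q i).2).
    apply/seteqP; split=> y /=.
      by move=> [cy Qy] i; rewrite -hq; split; [exact: cy|exact: Qy].
    by move=> h; split=> i; have := h i; rewrite -hq => -[].
  exact: integral_box_eq0.
apply: sub; rewrite setI_closed_g_dynkin_g_sigma_algebra.
  exact: sub_measurable_open_boxes.
exact: setI_closed_open_boxes.
Qed.

(** The fundamental lemma of the calculus of variations: on each of countably
    many boxes covering the space, [u] has the same integral as 0 over every
    Borel subset. *)
Lemma ae_eq0_test u : rV_locally_integrable u ->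
  (forall v, test_function v -> (\int[leb]_x (u x * v x)%:E = 0)%E) ->
  {ae leb, forall x, u x = 0}.
Proof.
move=> lu hu; pose Q (k : nat) := box (fun=> - k%:R) (fun=> k%:R).
have mQ k : measurable (Q k) by exact: measurable_boxes.
have aeQ k : ae_eq leb (Q k) (EFin \o u) (cst 0%E).
  apply: integral_ae_eq => //.
  - apply: integrableS (integrable_cube k%:R lu) => //.
      exact: measurable_cube.
    move=> y Qy i; have := Qy i; rewrite /= !in_itv/= => /andP[h1 h2].
    by rewrite !ltW.
  - move=> A AQ mA.
    rewrite integral0 -[RHS](integral_setI_box_eq0 k%:R lu hu mA).
    by congr integral; rewrite setIidl.
have : {ae leb, forall x, forall k, Q k x -> u x = 0}.
  apply: ae_foralln => k; have := aeQ k; apply: filterS => x h Qx.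
  by have [] := h Qx.
apply: filterS => x h; pose k := Num.truncn (\sum_i `|x ord0 i|).
apply: (h k.+1) => i /=; rewrite in_itv/= -ltr_norml.
apply: (@le_lt_trans _ _ (\sum_i `|x ord0 i|)).
  by rewrite (bigD1 i)//= lerDl sumr_ge0.
exact: truncnS_gt.
Qed.

End du_bois_reymond.

Section weak_derivative_unique.
Variables (R : realType) (n : nat).
Local Notation leb := (lebesgue_rV R n).
Implicit Types g w v : 'rV[R]_n -> R.

Lemma integrable_test w v : rV_locally_integrable w -> test_function v ->
  leb.-integrable setT (fun x => (w x * v x)%:E).
Proof.
move=> lw tv; have [M vM] := test_function_supp tv.
have [cv _] := test_partials [::] tv.
have [C C0 HC] := cube_bounded M cv.
apply: (@le_integrable _ _ _ _ _ _ _
  (fun x => C%:E * (`|w x| * \1_(cube M) x)%:E)%E) => //.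
- apply/measurable_EFinP; apply: measurable_funM; first exact: lw.1.
  exact: continuous_measurable_rV.
- move=> x _; rewrite -EFinM lee_fin normrM indicE.
  have [Mx|nMx] := pselect (cube M x).
    rewrite mem_set// mulr1 normrM normr_id mulrC ler_wpM2r//.
    by rewrite (ger0_norm C0) HC.
  by rewrite (vM _ nMx) mulr0 normr0 mulr_ge0.
- by apply: integrableZl => //; exact: integrable_abs_cube.
Qed.

Lemma rV_locally_integrableB w1 w2 : rV_locally_integrable w1 ->
  rV_locally_integrable w2 -> rV_locally_integrable (fun x => w1 x - w2 x).
Proof.
move=> [m1 h1] [m2 h2]; split; first exact: measurable_funB.
move=> K cK; have mK := compact_measurable_rV cK.
have ma w : measurable_fun setT w -> measurable_fun K (fun x => `|w x|%:E).
  move=> mw; apply/measurable_EFinP; apply: measurable_funTS.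
  exact: measurableT_comp.
apply: (@le_lt_trans _ _ (\int[leb]_(x in K) (`|w1 x|%:E + `|w2 x|%:E))%E).
  apply: ge0_le_integral => //.
  - by apply: ma; exact: measurable_funB.
  - by apply: emeasurable_funD; exact: ma.
  - by move=> x _; rewrite -EFinD lee_fin ler_normB.
rewrite ge0_integralD//; [|exact: ma|exact: ma].
by apply: lte_add_pinfty; [exact: h1|exact: h2].
Qed.

Lemma weak_derivative_unique eta g w1 w2 : is_weak_derivative eta g w1 ->
  is_weak_derivative eta g w2 -> {ae leb, forall x, w1 x = w2 x}.
Proof.
move=> [l1 h1] [l2 h2].
have := ae_eq0_test (rV_locally_integrableB l1 l2).
have H v : test_function v -> (\int[leb]_x ((w1 x - w2 x) * v x)%:E = 0)%E.
  move=> tv; have I1 := integrable_test l1 tv; have I2 := integrable_test l2 tv.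
  under eq_integral do rewrite mulrBl EFinB.
  rewrite integralB//.
  have E : (\int[leb]_x (w1 x * v x)%:E = \int[leb]_x (w2 x * v x)%:E)%E.
    have := h1 v tv; rewrite h2// => /(congr1 (mule ((-1) ^+ mnorm eta)%:E)).
    by rewrite !muleA -EFinM -expr2 sqrr_sign !mul1e.
  by rewrite E subee// integrable_fin_num.
move=> /(_ H); apply: filterS => x /eqP.
by rewrite subr_eq0 => /eqP.
Qed.

Lemma weak_deriveP eta g w : is_weak_derivative eta g w ->
  {ae leb, forall x, weak_derive eta g x = w x}.
Proof.
move=> hw; apply: (weak_derivative_unique _ hw).
by have := @getPex _ [set w | is_weak_derivative eta g w]; apply; exists w.
Qed.

End weak_derivative_unique.

Lemma sqr_sum_le (R : realFieldType) (I : Type) (s : seq I) (x : I -> R) :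
  (\sum_(i <- s) x i) ^+ 2 <= (size s)%:R * \sum_(i <- s) x i ^+ 2.
Proof.
elim: s => [|i s IH]; first by rewrite !big_nil expr0n mulr0.
rewrite !big_cons /= -natr1.
have Q0 : 0 <= \sum_(j <- s) x j ^+ 2 by apply: sumr_ge0 => j _; exact: sqr_ge0.
move: (\sum_(j <- s) x j) (\sum_(j <- s) x j ^+ 2) (x i) IH Q0 => S Q z IH Q0.
case: (size s) IH => [|m] IH.
  have -> : S = 0.
    apply/eqP; rewrite -sqrf_eq0 eq_le sqr_ge0 andbT.
    by move: IH; rewrite mul0r.
  by rewrite addr0 add0r mul1r lerDl.
have m0 : 0 < m.+1%:R :> R by rewrite ltr0n.
move: (m.+1%:R) m0 IH => k k0 IH.
(* After multiplication by [k] the difference dominates this square. *)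
rewrite -subr_ge0 -(pmulr_rge0 _ k0).
have := sqr_ge0 (k * z - S); nra.
Qed.

(** * The norm bound *)

Section norm_bound.
Variables (R : realType) (d : nat) (phi : 'rV[R]_d.+1 -> R) (rho0 : R -> R).
Variables (rho psi : 'I_d -> R -> R) (nu : mindex d) (a b t : R).
Variable B : mindex d -> R.
Let nu' := mcons (mnorm nu).+1 nu.
Hypothesis phi_pos : forall x, 0 < partial ord0 phi x.
Hypothesis phiC : Cmi nu' phi.
Hypothesis rhoC : Ck (mnorm nu) rho0.
Hypothesis decay : forall eta, mle eta nu ->
  decay_condition phi rho0 rho psi 1 eta a b (B eta).
Hypothesis tab : t \in `[a, b].
Hypothesis mrho : forall i, measurable_fun setT (rho i).
Hypothesis mpsi : forall i, measurable_fun setT (psi i).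
Hypothesis rho_ge0 : forall i x, 0 <= rho i x.
Hypothesis psi_ge0 : forall i x, 0 <= psi i x.

Local Notation leb := (lebesgue_rV R d).
Local Notation weight := (mweight rho psi).
Local Notation P0g := (preint_delta phi rho0 t).

Lemma mweight_ge0 eta y : 0 <= weight eta y.
Proof. by rewrite mulr_ge0//; apply: prodr_ge0 => i _. Qed.

Lemma measurable_mweight eta : measurable_fun setT (weight eta).
Proof.
have mprod (P : pred 'I_d) (f : 'I_d -> R -> R) :
    (forall i, measurable_fun setT (f i)) ->
    measurable_fun setT (fun y : 'rV[R]_d => \prod_(i | P i) f i (y ord0 i)).
  move=> mf; elim: (index_enum _) => [|i s IH].
    under eq_fun do rewrite big_nil; exact: measurable_cst.
  under eq_fun do rewrite big_cons; case: (P i) => //.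
  apply: measurable_funM => //.
  by apply: measurableT_comp; [exact: mf|exact: measurable_coord].
by apply: measurable_funM; exact: mprod.
Qed.

Lemma term_ext_integral_le eta T : mle eta nu -> term_valid eta T ->
  (\int[leb]_y (`|term_ext phi rho0 t T y| ^+ 2 * weight eta y)%:E
     <= (B eta)%:E)%E.
Proof.
move=> le_eta vT; have [r [alpha [beta [pr E]]]] := term_type_fun phi rho0 t vT.
have [_ h] := decay le_eta pr; apply: le_trans h; apply: ereal_sup_ubound.
exists t; first exact: tab.
rewrite E integral_mkcond; apply: eq_integral => y _.
rewrite patchE /term_ext; case: ifP => // _.
by rewrite normr0 expr0n mul0r.
Qed.

(** The derivative is a sum of at most [8 ^ |eta| * |eta|`!] terms, so by the
    Cauchy-Schwarz inequality its square costs that number twice: once as a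
    factor and once in the count of the integrals bounded by [B eta]. *)
Lemma derivative_integral_le eta : mle eta nu ->
  (\int[leb]_y (`|weak_derive eta P0g y| ^+ 2 * weight eta y)%:E
     <= (((8 ^ mnorm eta * (mnorm eta)`!)%:R : R) ^+ 2 * B eta)%:E)%E.
Proof.
move=> le_eta.
have gC : Cmi nu P0g := Cmi_preint phi_pos phiC rhoC decay tab.
have [s sE ws] := weak_derivative_partials gC le_eta.
have le_s : mle (mcount s) nu by rewrite sE.
have [Ts [vTs /andP[Ts0 sTs] E]] :=
  partials_preint phi_pos phiC rhoC decay tab le_s.
have {}vTs T : T \in Ts -> term_valid eta T by rewrite -sE; exact: vTs.
have sizeE : size s = mnorm eta by rewrite -sE mnorm_mcount.
(* Terms outside [Ts] are set to 0, so that every [F T] is measurable. *)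
pose F (T : term d) y : \bar R :=
  if T \in Ts then (`|term_ext phi rho0 t T y| ^+ 2 * weight eta y)%:E else 0%E.
have F0 T y : (0 <= F T y)%E.
  by rewrite /F; case: ifP => // _; rewrite lee_fin mulr_ge0// mweight_ge0.
have mF T : measurable_fun setT (F T).
  rewrite /F; have [TTs|_] := boolP (T \in Ts); last exact: measurable_cst.
  apply/measurable_EFinP.
  apply: measurable_funM; last exact: measurable_mweight.
  apply: measurable_funX; apply: continuous_measurable_rV => y.
  have cT := continuous_term_ext phi_pos phiC rhoC decay tab le_eta (vTs T TTs).
  exact: (cvg_norm (cT y)).
have FB T : T \in Ts -> (\int[leb]_y F T y <= (B eta)%:E)%E.
  by move=> TTs; rewrite /F TTs; apply: term_ext_integral_le => //; exact: vTs.
have B0 : 0 <= B eta.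
  have [T TTs] : exists T, T \in Ts.
    by case: (Ts) Ts0 => // T Ts' _; exists T; rewrite mem_head.
  rewrite -lee_fin; apply: le_trans (FB _ TTs).
  by apply: integral_ge0 => y _; exact: F0.
have msq (w : 'rV[R]_d -> R) : measurable_fun setT w ->
    measurable_fun [set: 'rV[R]_d] (fun y => (`|w y| ^+ 2 * weight eta y)%:E).
  move=> mw; apply/measurable_EFinP; apply: measurable_funM.
    by apply: measurable_funX; exact: measurableT_comp.
  exact: measurable_mweight.
have mws : measurable_fun setT (weak_derive eta P0g).
  have : is_weak_derivative eta P0g (weak_derive eta P0g).
    have := @getPex _ [set w | is_weak_derivative eta P0g w].
    by apply; exists (partials s P0g).
  by case=> -[].
rewrite (@ae_eq_integral _ _ _ leb setT
  (fun y => (`|partials s P0g y| ^+ 2 * weight eta y)%:E)) //; first last.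
- by have := weak_deriveP ws; apply: filterS => y -> _.
- by apply: msq; have [[]] := ws.
- exact: msq.
apply: (@le_trans _ _ (\int[leb]_y ((size Ts)%:R%:E * \sum_(T <- Ts) F T y))%E).
  apply: ge0_le_integral => //.
  - by move=> y _; rewrite lee_fin mulr_ge0// mweight_ge0.
  - by apply: msq; have [[]] := ws.
  - by apply: measurable_funeM; exact: emeasurable_sum.
  move=> y _; have -> : (\sum_(T <- Ts) F T y = (\sum_(T <- Ts)
      (`|term_ext phi rho0 t T y| ^+ 2 * weight eta y))%:E)%E.
    by rewrite -sumEFin; apply: eq_big_seq => T TTs; rewrite /F TTs.
  rewrite -EFinM lee_fin -mulr_suml [leRHS]mulrA.
  rewrite ler_wpM2r ?mweight_ge0// E real_normK ?num_real//.
  under [in leRHS]eq_bigr do rewrite real_normK ?num_real//.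
  exact: sqr_sum_le.
rewrite ge0_integralZl//; first last.
- by move=> y _; apply: sume_ge0 => T _; exact: F0.
- exact: emeasurable_sum.
rewrite ge0_integral_sum//.
apply: (@le_trans _ _ ((size Ts)%:R%:E * ((size Ts)%:R * B eta)%:E)%E).
  apply: lee_wpmul2l; first by rewrite lee_fin.
  rewrite big_seq; apply: le_trans (lee_sum _ FB) _.
  rewrite -big_seq sumEFin lee_fin big_const_seq count_predT iter_addr_0.
  by rewrite mulr_natl.
rewrite -EFinM lee_fin mulrA -expr2 ler_wpM2r// lerXn2r ?nnegrE//.
by rewrite ler_nat -sizeE.
Qed.

End norm_bound.

Theorem theorem3p3 (R : realType) (d : nat) (hd : (1 <= d)%N)
    (rho psi : 'I_d.+1 -> R -> R) (gam : {set 'I_d.+1} -> R)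
    (hrho : forall i, density_full_support (rho i))
    (hpsi : forall i, weight_function (psi i))
    (hrhopsi : forall i : 'I_d,
      cdf_weight_condition (rho (lift ord0 i)) (psi (lift ord0 i)))
    (hgam : forall u, 0 < gam u) (hgam0 : gam (finset.set0) = 1)
    (nu : mindex d) (a b : R) (hab : a <= b)
    (phi : 'rV[R]_d.+1 -> R) (hphi : admissible rho psi gam nu phi)
    (B : mindex d -> R)
    (hdecay : forall eta, mle eta nu ->
      decay_condition phi (rho ord0) (rho \o lift ord0) (psi \o lift ord0)
        1 eta a b (B eta)) :
  let P0g := preint_delta phi (rho ord0) in
  let gam_d (u : {set 'I_d}) := gam (lift ord0 @: u) in
  let C (k : nat) : R := (8 ^ k * k`!)%:R in
  (forall t, t \in `[a, b] ->
     in_H (rho \o lift ord0) (psi \o lift ord0) gam_d nu (P0g t) /\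
     Cmi nu (P0g t)) /\
  (ereal_sup [set Hnorm (rho \o lift ord0) (psi \o lift ord0) gam_d nu (P0g t)
             | t in `[a, b]]
   <= (Num.sqrt (\sum_(e : below nu) let eta := mval e in
         C (mnorm eta) ^+ 2 * B eta / gam_d (msupp eta)))%:E < +oo)%E.
Proof.
move=> P0g gam_d C.
have [phi_pos _ [_ phiC] rhoC] := hphi.
have mrho (i : 'I_d) : measurable_fun setT ((rho \o lift ord0) i).
  by have [] := hrho (lift ord0 i).
have mpsi (i : 'I_d) : measurable_fun setT ((psi \o lift ord0) i).
  have [_ /measurable_int mp] := hpsi (lift ord0 i).
  by apply/measurable_EFinP; exact: mp.
have rho_ge0 (i : 'I_d) x : 0 <= (rho \o lift ord0) i x.
  by have [_ h _ _] := hrho (lift ord0 i); exact: h.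
have psi_ge0 (i : 'I_d) x : 0 <= (psi \o lift ord0) i x.
  by have [h _] := hpsi (lift ord0 i); exact/ltW/h.
pose S := \sum_(e : below nu) C (mnorm (mval e)) ^+ 2 * B (mval e) /
  gam_d (msupp (mval e)).
have mval_le (e : below nu) : mle (mval e) nu.
  by apply/mleP => i; rewrite ffunE -ltnS ltn_ord.
have norm_le t : t \in `[a, b] ->
    (Hnorm (rho \o lift ord0) (psi \o lift ord0) gam_d nu (P0g t)
      <= (Num.sqrt S)%:E)%E.
  move=> tab; rewrite /Hnorm.
  set A := (\sum_(e : below nu) _)%E.
  have A0 : (0 <= A)%E.
    apply: sume_ge0 => e _; apply: mule_ge0.
      by rewrite lee_fin invr_ge0 ltW// hgam.
    apply: integral_ge0 => y _; rewrite lee_fin mulr_ge0//.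
    exact: mweight_ge0.
  have AS : (A <= S%:E)%E.
    rewrite /A -sumEFin; apply: lee_sum => e _ /=.
    rewrite [in leRHS]mulrC EFinM; apply: lee_wpmul2l.
      by rewrite lee_fin invr_ge0 ltW// hgam.
    exact: (derivative_integral_le phi_pos phiC rhoC hdecay tab).
  have S0 : 0 <= S by rewrite -lee_fin (le_trans A0).
  rewrite -(powR12_sqrt S0) -poweR_EFin.
  apply: gt0_ler_poweR => //; rewrite ?invr_ge0//.
    by rewrite in_itv/= A0 leey.
  by rewrite in_itv/= lee_fin S0 leey.
split.
  move=> t tab.
  have gC : Cmi nu (P0g t) := Cmi_preint phi_pos phiC rhoC hdecay tab.
  split=> //; split.
  - apply: continuous_locally_integrable; apply: (gC [::] _).1 => i.
    exact: leq0n.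
  - move=> eta le_eta; have [s _ ws] := weak_derivative_partials gC le_eta.
    by exists (partials s (P0g t)).
  - by apply: le_lt_trans (norm_le t tab) _; rewrite ltry.
rewrite ltry andbT; apply: ub_ereal_sup => _ [t tab <-].
exact: norm_le.
Qed.
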